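(* Let $\Gamma\in\mathbb{R}$, $\Gamma\neq 0$, and let $t\mapsto (z_1(t),z_2(t),z_3(t),z_4(t))\in\mathbb{C}^4$, $t\in\mathbb{R}$, be a solution of the Kirchhoff equations for four point vortices with identical intensities $\Gamma$, with $z_1(t),\dots,z_4(t)$ pairwise distinct for all $t$, with (conserved) center $z_c\in\mathbb{C}$ and (conserved) impulse $I>0$. Put $\omega=\dfrac{3\Gamma}{\pi I}$. Then the configuration $(z_1(0),\dots,z_4(0))$ is a stationary configuration if and only if, after a permutation of the indices of the vortices and a rotation of the plane about $z_c$ by a fixed angle (independent of $t$ and of the index), the solution is one of the following, for all $t\in\mathbb{R}$: 1. (Square configuration) $z_j(t)=z_c+\frac12\sqrt{I}\,e^{i(\omega t+\frac{\pi}{2}(j-1))}$ for $j=1,2,3,4$. 2. (Collinear configuration) $z_j(t)=z_c+\frac{1}{2\sqrt{3-\sqrt6}}\sqrt{I}\,e^{i(\omega t+\pi(j-1))}$ for $j=1,2$, and $z_j(t)=z_c+\frac{1}{2\sqrt{3+\sqrt6}}\sqrt{I}\,e^{i(\omega t+\pi(j-1))}$ for $j=3,4$. 3. (Equilateral triangle with a center configuration) $z_1(t)=z_c$, and $z_j(t)=z_c+\frac{1}{\sqrt3}\sqrt{I}\,e^{i(\omega t+\frac{2\pi}{3}(j-2))}$ for $j=2,3,4$. Moreover, on the constrained phase space $\mathcal{Z}_{z_c,I}$ of configurations with center $z_c$ and impulse $I$, the square configuration is the unique global minimizer of the Hamiltonian $W$ (unique up to reindexing of the vortices and rotation about $z_c$),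 whereas the collinear configuration and the equilateral triangle with a center configuration are saddle points of $W$.
   Context: A configuration is a quadruple $(z_1,z_2,z_3,z_4)\in\mathbb{C}^4$ of pairwise distinct points, with $z_j=x_j+iy_j$. With identical intensities $\Gamma$ the Hamiltonian is $W(z_1,\dots,z_4)=-\frac{\Gamma^2}{2\pi}\sum_{1\le i<j\le4}\log|z_i-z_j|$, and the Kirchhoff equations are $\Gamma\frac{dx_j}{dt}=\frac{\partial W}{\partial y_j}$, $\Gamma\frac{dy_j}{dt}=-\frac{\partial W}{\partial x_j}$, $j=1,\dots,4$. For a configuration, $\dot z_j=\dot x_j+i\dot y_j$ denotes the velocity assigned to the $j$th vortex by these equations. The center of a configuration is $\bar z=\frac14\sum_{j=1}^4 z_j$ and its impulse is $I=\sum_{j=1}^4|z_j-\bar z|^2$; both are conserved along solutions. A configuration is a stationary configuration if there is a constant $\omega'\in\mathbb{C}$ such that $\dot z_i-\dot z_j=\omega'(z_i-z_j)$ for all $1\le i<j\le 4$. $\mathcal{Z}_{z_c,I}=\{(z_1,\dots,z_4)\in\mathbb{C}^4:\ \frac14\sum_j z_j=z_c,\ \sum_j|z_j-z_c|^2=I,\ z_i\ne z_j\text{ for all }i\neq j\}$, a smooth manifold. A saddle point of $W$ on $\mathcal{Z}_{z_c,I}$ is a critical point of $W|_{\mathcal{Z}_{z_c,I}}$ that is neither a local minimum nor a local maximum of $W|_{\mathcal{Z}_{z_c,I}}$. The configurations in the last assertion are the positions occurring in items 1, 2, 3 (at any time, in any indexing and after any rotation about $z_c$). *)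

(* Defs.v *)
From HB Require Import structures.
From mathcomp Require Import all_boot all_order all_algebra all_fingroup.
From mathcomp Require Import all_classical all_reals all_analysis.
From mathcomp Require Import complex.

Set Implicit Arguments.
Unset Strict Implicit.
Unset Printing Implicit Defensive.

Import Order.TTheory GRing.Theory Num.Theory.
Import numFieldNormedType.Exports.
Import ComplexField.Normc.

Local Open Scope ring_scope.
Local Open Scope complex_scope.

(* The vortices are numbered 0, 1, 2, 3: the vortex z_j of the literature is
   [z (j - 1)].  The real-valued modulus is [normc]; the norm [`|z|] of R[i] is
   R[i]-valued. *)
Definition quadruple (R : realType) := 'I_4 -> R[i].

Section Vortices.
Variable R : realType.
Implicit Types (Gamma I t theta : R) (zc w : R[i]) (z : quadruple R).

Definition configuration z := forall i j : 'I_4, i != j -> z i != z j.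

Definition hamiltonian Gamma z : R :=
  - (Gamma ^+ 2 / (2 * pi)) *
    \sum_(i < 4) \sum_(j < 4 | (i < j)%N) ln (normc (z i - z j)).

(* [derive1] is total; both partial derivatives do exist at configurations. *)
Definition dWdx Gamma z (j : 'I_4) : R :=
  derive1 (fun s : R =>
    hamiltonian Gamma [eta z with j |-> s +i* complex.Im (z j)])
  (complex.Re (z j)).

Definition dWdy Gamma z (j : 'I_4) : R :=
  derive1 (fun s : R =>
    hamiltonian Gamma [eta z with j |-> complex.Re (z j) +i* s])
  (complex.Im (z j)).

Definition velocity Gamma z (j : 'I_4) : R[i] :=
  (dWdy Gamma z j / Gamma) +i* (- dWdx Gamma z j / Gamma).

Definition kirchhoff_solution Gamma (z : R -> quadruple R) :=
  forall (t : R) (j : 'I_4),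
    let x := fun s : R => complex.Re (z s j) in
    let y := fun s : R => complex.Im (z s j) in
    [/\ derivable x t 1, derivable y t 1,
        Gamma * derive1 x t = dWdy Gamma (z t) j
      & Gamma * derive1 y t = - dWdx Gamma (z t) j].

Definition vortex_center z : R[i] := 4^-1 * \sum_(j < 4) z j.

Definition vortex_impulse z : R :=
  \sum_(j < 4) normc (z j - vortex_center z) ^+ 2.

Definition stationary Gamma z :=
  configuration z /\
  exists omega' : R[i], forall i j : 'I_4, (i < j)%N ->
    velocity Gamma z i - velocity Gamma z j = omega' * (z i - z j).

Definition cexpi theta : R[i] := cos theta +i* sin theta.

Definition rotation zc theta w : R[i] := zc + cexpi theta * (w - zc).

Definition omega Gamma I : R := 3 * Gamma / (pi * I).

Definition square_motion Gamma zc I t : quadruple R := fun j =>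
  zc + (2^-1 * Num.sqrt I)%:C * cexpi (omega Gamma I * t + pi / 2 * j%:R).

Definition collinear_motion Gamma zc I t : quadruple R := fun j =>
  let r := if (j < 2)%N then (2 * Num.sqrt (3 - Num.sqrt 6))^-1
           else (2 * Num.sqrt (3 + Num.sqrt 6))^-1 in
  zc + (r * Num.sqrt I)%:C * cexpi (omega Gamma I * t + pi * j%:R).

Definition triangle_motion Gamma zc I t : quadruple R := fun j =>
  if j == ord0 then zc
  else zc + ((Num.sqrt 3)^-1 * Num.sqrt I)%:C
            * cexpi (omega Gamma I * t + 2 * pi / 3 * j.-1%:R).

Definition transformed zc (sigma : 'S_4) theta z : quadruple R :=
  fun j => rotation zc theta (z (sigma j)).

Definition position_of zc (motion : R -> quadruple R) z :=
  exists (sigma : 'S_4) (theta t : R),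
    transformed zc sigma theta z =1 motion t.

Definition phase_space zc I z :=
  [/\ 4^-1 * \sum_(j < 4) z j = zc,
      \sum_(j < 4) normc (z j - zc) ^+ 2 = I & configuration z].

Definition near_quadruple (e : R) z z' :=
  forall j : 'I_4, normc (z' j - z j) < e.

Definition local_minimum Gamma zc I z :=
  exists2 e : R, 0 < e & forall z', phase_space zc I z' ->
    near_quadruple e z z' -> hamiltonian Gamma z <= hamiltonian Gamma z'.

Definition local_maximum Gamma zc I z :=
  exists2 e : R, 0 < e & forall z', phase_space zc I z' ->
    near_quadruple e z z' -> hamiltonian Gamma z' <= hamiltonian Gamma z.

(* The differential of the restriction of W to the manifold vanishes at z: the
   tangent vectors at z are the velocities of the curves in the manifold
   through z. *)
Definition critical_point Gamma zc I z :=
  phase_space zc I z /\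
  forall c : R -> quadruple R,
    c 0 = z ->
    (\forall t \near (0 : R), phase_space zc I (c t)) ->
    (forall j : 'I_4, derivable (fun t : R => complex.Re (c t j)) 0 1 /\
                      derivable (fun t : R => complex.Im (c t j)) 0 1) ->
    is_derive (0 : R) (1 : R) (fun t : R => hamiltonian Gamma (c t)) 0.

Definition saddle_point Gamma zc I z :=
  [/\ critical_point Gamma zc I z, ~ local_minimum Gamma zc I z
    & ~ local_maximum Gamma zc I z].

Definition global_minimizer Gamma zc I z :=
  phase_space zc I z /\
  forall z', phase_space zc I z' ->
    hamiltonian Gamma z <= hamiltonian Gamma z'.

End Vortices.

(* Main.v *)
Require Import Defs.
From HB Require Import structures.
From mathcomp Require Import all_boot all_order all_algebra all_fingroup.
From mathcomp Require Import all_classical all_reals all_analysis.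
From mathcomp Require Import complex ring lra.

Set Implicit Arguments.
Unset Strict Implicit.
Unset Printing Implicit Defensive.

Import Order.TTheory GRing.Theory Num.Theory.
Import numFieldNormedType.Exports.

Local Open Scope ring_scope.
Local Open Scope complex_scope.

(** The proof rests on one change of coordinates.  Let [a], [b], [c] be the sums
    of the four positions weighted by the nontrivial characters of the Klein
    four-group of double transpositions ([a = z0 + z1 - z2 - z3], and so on).
    Together with the center they determine the configuration, the impulse is
    [(|a|^2 + |b|^2 + |c|^2) / 4], and the six differences [zi - zj] are the six
    numbers [(a +- b)/2], [(a +- c)/2], [(b +- c)/2].  Hence, for
    [A = a^2], [B = b^2], [C = c^2],

       the product of the six distances is [|(A - B) (B - C) (C - A)| / 64],
       and four times the impulse is [|A| + |B| + |C|]: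

    four points under a quadratic constraint become three points under a linear
    one, and the Hamiltonian is a decreasing function of
    [|(A - B) (B - C) (C - A)|].

    Minimizers.  An elementary inequality ([disc3_bound]) says that
    [4 |(A - B) (B - C) (C - A)| <= (|A| + |B| + |C|)^3], with equality only if
    one of the three numbers is [0] and the other two are opposite.  Those
    triples are the squares ([square_of_triple]).

    Stationary configurations.  The moment identity
    [sum_mul_reciprocal_sum] forces the constant [omega'] to be [i omega], so
    that a stationary configuration satisfies
    [sum_i 1/(zj - zi) = (6/I) conj (zj - zc)] for all [j].  In the new
    coordinates this reads [A (1/(A - B) + 1/(A - C)) = k |A|] with
    [k = 3/(4 I)], together with the two equations obtained by cyclic permutation
    ([relative_equilibrium_quad]).  If [A], [B], [C] are all nonzero, division by
    [A], [B], [C] and addition give [|A|/A + |B|/B + |C|/C = 0]: the three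
    directions are at angles of 120 degrees, and comparing imaginary parts then
    makes the three moduli equal.  This is the triangle with its center.  If
    [C = 0], the equations force [B = t A] with [t] real, and either [t = -1]
    (the square) or [t^2 - 4 t + 1 = 0] (the collinear configuration).  See
    [triple_classification].

    Motions.  The rigid rotation with rate [omega] of a configuration satisfying
    these equations solves the Kirchhoff equations, and solutions are unique by
    a Gronwall estimate of [sum_j |zj - yj|^2] ([follows_field_unique]), so a
    solution starting at a stationary configuration is that rotation.
    Conversely, the velocity at time [0] of a rigid rotation is the one required
    of a stationary configuration.

    Saddles.  The same equations say that the differential of the Hamiltonian
    is proportional to that of the impulse, whence criticality
    ([relative_equilibrium_critical]).  Explicit deformations of [a], [b], [c]
    which preserve [|a|^2 + |b|^2 + |c|^2] make [|(A - B) (B - C) (C - A)|]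
    larger or smaller, as close to the configuration as desired
    ([aligned_saddle], [equilateral_saddle]). *)

(* Both scopes carry a conjugation; in this file it is always [conjc]. *)
Local Notation "x ^*" := (conjc x) : ring_scope.

(** * Moduli of complex numbers *)
Section Modulus.
Variable R : realType.
Implicit Types (u v w : R[i]) (x : R).

(** The real modulus, with codomain the carrier of [R] itself: this keeps the
    canonical structures found on moduli and on other reals identical. *)
Definition modulus w : R := ComplexField.Normc.normc w.

Lemma sqr_modulusE w :
  modulus w ^+ 2 = complex.Re w ^+ 2 + complex.Im w ^+ 2.
Proof. by case: w => x y; rewrite sqr_sqrtr // addr_ge0 ?sqr_ge0. Qed.

Lemma sqr_modulus w : (modulus w ^+ 2)%:C = w * w^*.
Proof. by rewrite sqr_modulusE; case: w => x y; simpc; congr (_ +i* _); ring. Qed.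

Lemma modulus_ge0 w : 0 <= modulus w.
Proof. by case: w => x y; exact: sqrtr_ge0. Qed.

Lemma modulus_eq0 w : (modulus w == 0) = (w == 0).
Proof.
by apply/eqP/eqP => [/ComplexField.Normc.eq0_normc //|->];
  exact: ComplexField.Normc.normc0.
Qed.

Lemma modulus_gt0 w : (0 < modulus w) = (w != 0).
Proof. by rewrite lt_def modulus_eq0 modulus_ge0 andbT. Qed.

Lemma modulusM v w : modulus (v * w) = modulus v * modulus w.
Proof. exact: ComplexField.Normc.normcM. Qed.

Lemma modulusV w : modulus w^-1 = (modulus w)^-1.
Proof. exact: ComplexField.Normc.normcV. Qed.

Lemma modulusN w : modulus (- w) = modulus w.
Proof. exact: normcN. Qed.

Lemma modulusR x : modulus x%:C = `|x|.
Proof. by rewrite /modulus /= expr0n addr0 sqrtr_sqr. Qed.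

Lemma modulus_real x : 0 <= x -> modulus x%:C = x.
Proof. by rewrite modulusR => /ger0_norm. Qed.

Lemma modulus_conj w : modulus w^* = modulus w.
Proof. by case: w => x y; rewrite /modulus /= sqrrN. Qed.

Lemma modulusX w n : modulus (w ^+ n) = modulus w ^+ n.
Proof.
elim: n => [|n IHn]; first by rewrite !expr0 modulus_real.
by rewrite !exprS modulusM IHn.
Qed.

Lemma ler_modulusD v w : modulus (v + w) <= modulus v + modulus w.
Proof. exact: le_normcD. Qed.

Lemma ler_modulusB v w : modulus (v - w) <= modulus v + modulus w.
Proof. by rewrite -[modulus w]modulusN; exact: ler_modulusD. Qed.

Lemma modulusBC v w : modulus (v - w) = modulus (w - v).
Proof. by rewrite -[RHS]modulusN opprB. Qed.

Lemma ler_Re_modulus w : `|complex.Re w| <= modulus w.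
Proof. by rewrite -lecR; have := normc_ge_Re w; rewrite normc_def; case: w. Qed.

Lemma modulus_parallelogram v w :
  modulus (v + w) ^+ 2 + modulus (v - w) ^+ 2
    = 2 * (modulus v ^+ 2 + modulus w ^+ 2).
Proof.
by rewrite !sqr_modulusE; case: v => a b; case: w => c d; simpc => /=; ring.
Qed.

Lemma modulus_i : modulus 'i%C = 1.
Proof. by rewrite /modulus /= expr0n add0r expr1n sqrtr1. Qed.

End Modulus.

(** * The product of the differences of three complex numbers *)
Section Discriminant.
Variable R : realType.
Implicit Types A B C : R[i].

(** Here [r <= p, q] stand for the moduli of [C], [A], [B], and [m], [n] for
    those of [A - B] and [A + B]; the parallelogram law ties them together and
    yields [m n <= p^2 + q^2].  Every term on the left is nonnegative, so that
    equality in the final bound kills each of them. *)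
Let disc3_real_bound (p q r m n : R) :
  0 <= r -> r <= p -> r <= q -> 0 <= m -> m <= p + q -> 0 <= n ->
  m ^+ 2 + n ^+ 2 = 2 * (p ^+ 2 + q ^+ 2) ->
  (p - q) ^+ 2 * (p + q - r) + 2 * (p * q * r) + r ^+ 3
     + 4 * ((p + q - m) * (p * q + r ^+ 2))
  <= (p + q + r) ^+ 3 - 4 * (m * (p * q + r * n + r ^+ 2)).
Proof.
move=> r0 rp rq m0 mpq n0 mn.
have mn_le : m * n <= p ^+ 2 + q ^+ 2 by have := sqr_ge0 (m - n); lra.
have h1 : 0 <= r * (p ^+ 2 + q ^+ 2 - m * n) by rewrite mulr_ge0// subr_ge0.
have h2 : 0 <= r * p * (q - r) by rewrite !mulr_ge0// ?subr_ge0// (le_trans r0).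
have h3 : 0 <= r * q * (p - r) by rewrite !mulr_ge0// ?subr_ge0// (le_trans r0).
lra.
Qed.

(** If [C] has the smallest modulus, [(B - C) (C - A) = C (A + B) - A B - C^2]
    is estimated termwise. *)
Let disc3_sorted A B C :
  modulus C <= modulus A -> modulus C <= modulus B ->
  4 * modulus ((A - B) * (B - C) * (C - A))
    <= (modulus A + modulus B + modulus C) ^+ 3 /\
  (0 < modulus A + modulus B + modulus C ->
   4 * modulus ((A - B) * (B - C) * (C - A))
     = (modulus A + modulus B + modulus C) ^+ 3 -> C = 0 /\ A = - B).
Proof.
move=> CA CB.
set p := modulus A; set q := modulus B; set r := modulus C.
set m := modulus (A - B); set n := modulus (A + B).
have r0 : 0 <= r by exact: modulus_ge0.
have p0 : 0 <= p by exact: modulus_ge0.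
have q0 : 0 <= q by exact: modulus_ge0.
have m0 : 0 <= m by exact: modulus_ge0.
have pq0 : 0 <= p * q by rewrite mulr_ge0.
have mpq : m <= p + q by exact: ler_modulusB.
have mn : m ^+ 2 + n ^+ 2 = 2 * (p ^+ 2 + q ^+ 2).
  by rewrite addrC; exact: modulus_parallelogram.
have le1 : modulus ((A - B) * (B - C) * (C - A)) <= m * (p * q + r * n + r ^+ 2).
  rewrite -mulrA modulusM ler_wpM2l//.
  have -> : (B - C) * (C - A) = C * (A + B) - A * B - C ^+ 2 by ring.
  rewrite (le_trans (ler_modulusB _ _))// modulusX lerD2r.
  by rewrite (le_trans (ler_modulusB _ _))// !modulusM addrC.
have := @disc3_real_bound p q r m n r0 CA CB m0 mpq (modulus_ge0 _) mn.
have t1 : 0 <= (p - q) ^+ 2 * (p + q - r).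
  by rewrite mulr_ge0 ?sqr_ge0// subr_ge0 (le_trans CA)// lerDl.
have t2 : 0 <= p * q * r by rewrite mulr_ge0.
have t3 : 0 <= r ^+ 3 by rewrite exprn_ge0.
have t4 : 0 <= (p + q - m) * (p * q + r ^+ 2).
  by rewrite mulr_ge0 ?subr_ge0// addr_ge0// sqr_ge0.
move: le1; set X := modulus (_ * _) => le1 main.
split; first by clearbody p q r m n X; lra.
move=> s0 E.
have r_0 : r = 0.
  have : r ^+ 3 == 0 by apply/eqP; lra.
  by rewrite expf_eq0 => /eqP.
have C0 : C = 0 by apply/eqP; rewrite -modulus_eq0; apply/eqP.
split=> //.
have pq : p = q.
  have : (p - q) ^+ 2 * (p + q - r) == 0 by apply/eqP; lra.
  rewrite r_0 subr0 mulf_eq0 sqrf_eq0 subr_eq0 => /orP[/eqP//|/eqP pq].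
  by move: s0; rewrite -/p -/q -/r r_0 pq addr0 ltxx.
have p_gt0 : 0 < p by move: s0; rewrite -/p -/q -/r -pq r_0; lra.
have m2 : m = 2 * p.
  have : (p + q - m) * (p * q + r ^+ 2) == 0 by apply/eqP; lra.
  rewrite -pq r_0 expr0n addr0 mulf_eq0 mulf_eq0 orbb (gt_eqF p_gt0) orbF.
  by move/eqP; lra.
apply/eqP; rewrite -subr_eq0 opprK -modulus_eq0 -sqrf_eq0 -/n; apply/eqP.
by move: mn; rewrite m2 -pq; lra.
Qed.

Definition one_zero_two_opposite A B C :=
  [\/ C = 0 /\ A = - B, A = 0 /\ B = - C | B = 0 /\ C = - A].

(** The configurations with the smallest energy are the equality cases; the
    constant is attained at [(1, -1, 0)]. *)
Lemma disc3_bound A B C :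
  4 * modulus ((A - B) * (B - C) * (C - A))
    <= (modulus A + modulus B + modulus C) ^+ 3 /\
  (0 < modulus A + modulus B + modulus C ->
   4 * modulus ((A - B) * (B - C) * (C - A))
     = (modulus A + modulus B + modulus C) ^+ 3 -> one_zero_two_opposite A B C).
Proof.
have [CA|/ltW AC] := leP (modulus C) (modulus A).
  have [CB|/ltW BC] := leP (modulus C) (modulus B).
    have [h1 h2] := disc3_sorted CA CB.
    by split=> // s0 /(h2 s0); constructor 1.
  have [] := disc3_sorted BC (le_trans BC CA).
  have -> : (C - A) * (A - B) * (B - C) = (A - B) * (B - C) * (C - A) by ring.
  have -> : modulus C + modulus A + modulus B = modulus A + modulus B + modulus C by ring.
  by move=> h1 h2; split=> // s0 /(h2 s0); constructor 3.
have [AB|/ltW BA] := leP (modulus A) (modulus B).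
  have [] := disc3_sorted AB AC.
  have -> : (B - C) * (C - A) * (A - B) = (A - B) * (B - C) * (C - A) by ring.
  have -> : modulus B + modulus C + modulus A = modulus A + modulus B + modulus C by ring.
  by move=> h1 h2; split=> // s0 /(h2 s0); constructor 2.
have [] := disc3_sorted (le_trans BA AC) BA.
have -> : (C - A) * (A - B) * (B - C) = (A - B) * (B - C) * (C - A) by ring.
have -> : modulus C + modulus A + modulus B = modulus A + modulus B + modulus C by ring.
by move=> h1 h2; split=> // s0 /(h2 s0); constructor 3.
Qed.

End Discriminant.

(** * The equations of a relative equilibrium for three complex numbers *)
Section TripleEquations.
Variable R : realType.
Implicit Types (A B C zeta u v w : R[i]) (p q r kappa : R).

(** A primitive cube root of unity is not real, hence [1] and [zeta] are
    independent over the reals. *)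
Lemma cube_root_free zeta (x y : R) :
  zeta ^+ 2 + zeta + 1 = 0 -> x%:C + y%:C * zeta = 0 -> x = 0 /\ y = 0.
Proof.
case: zeta => s t; rewrite expr2; simpc => -[re im] [xE yt].
have t0 : t != 0.
  by apply/eqP => t0; move: re; rewrite t0; have := sqr_ge0 (2 * s + 1); lra.
have y0 : y = 0 by apply/eqP; move/eqP: yt; rewrite mulf_eq0 (negPf t0) orbF.
by move: xE; rewrite y0 mul0r addr0.
Qed.

(** Clearing denominators and reducing modulo [zeta^2 + zeta + 1] leaves, as
    coefficient of [zeta], [(r - q) (1 - kappa p) = 0]; if [kappa p = 1] the
    constant coefficient becomes [p^2 = q r]. *)
Let cube_root_weights zeta p q r kappa :
  zeta ^+ 2 + zeta + 1 = 0 -> 0 < p -> 0 < q -> 0 < r ->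
  (p%:C - q%:C * zeta)^-1 + (p%:C - r%:C * zeta ^+ 2)^-1 = kappa%:C ->
  q = r \/ p ^+ 2 = q * r.
Proof.
move=> zeta3 p0 q0 r0 E.
have d1 : p%:C - q%:C * zeta != 0.
  apply/eqP => d0; have [] := @cube_root_free zeta p (- q) zeta3; last by lra.
  by rewrite -d0; ring.
have d2 : p%:C - r%:C * zeta ^+ 2 != 0.
  apply/eqP => d0; have [] := @cube_root_free zeta (p + r) r zeta3; last by lra.
  by rewrite -d0 -[RHS]addr0 -[in RHS](mulr0 r%:C) -zeta3; ring.
have {E} E : 2 * p%:C - q%:C * zeta - r%:C * zeta ^+ 2
    = kappa%:C * ((p%:C - q%:C * zeta) * (p%:C - r%:C * zeta ^+ 2)).
  by rewrite -E; field; rewrite d1 d2.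
have z3 : zeta ^+ 3 = 1.
  have : (zeta - 1) * (zeta ^+ 2 + zeta + 1) = 0 by rewrite zeta3 mulr0.
  by move=> h; apply/eqP; rewrite -subr_eq0; apply/eqP; rewrite -h; ring.
have z2 : zeta ^+ 2 = - zeta - 1.
  by apply/eqP; rewrite -subr_eq0; apply/eqP; rewrite -zeta3; ring.
have [e1 e2] := @cube_root_free zeta
  (2 * p + r - kappa * (p ^+ 2 + p * r + q * r)) ((r - q) * (1 - kappa * p))
  zeta3 ltac:(
    transitivity (2 * p%:C - q%:C * zeta - r%:C * zeta ^+ 2
      - kappa%:C * (p%:C ^+ 2 - p%:C * r%:C * zeta ^+ 2 - p%:C * q%:C * zeta
                    + q%:C * r%:C * zeta ^+ 3));
    [by rewrite z3 z2; ring | rewrite E; ring]).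
move/eqP: e2; rewrite mulf_eq0 subr_eq0 => /orP[/eqP ->|/eqP kp]; first by left.
right; have : p * (2 * p + r - kappa * (p ^+ 2 + p * r + q * r)) = 0.
  by rewrite e1 mulr0.
have -> : p * (2 * p + r - kappa * (p ^+ 2 + p * r + q * r))
  = p ^+ 2 - q * r + (1 - kappa * p) * (p ^+ 2 + p * r + q * r) by ring.
by rewrite kp mul0r addr0; lra.
Qed.

(** Two of three positive numbers cannot both be geometric means of the other
    two unless all three are equal. *)
Let geometric_means p q r : 0 < p -> 0 < q -> 0 < r ->
  q = r \/ p ^+ 2 = q * r -> r = p \/ q ^+ 2 = r * p ->
  p = q \/ r ^+ 2 = p * q -> p = q /\ q = r.
Proof.
move=> p0 q0 r0 qr_or rp_or pq_or.
have aux (x y : R) : 0 < x -> 0 < y -> x ^+ 2 = y * x -> x = y.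
  by move=> x0 y0; rewrite expr2 => /(mulIf (lt0r_neq0 x0)).
have [qr|qr] := eqVneq q r.
  split=> //; move: rp_or; rewrite qr => -[->//|rE].
  by apply/esym/(aux _ _ r0 p0); rewrite rE mulrC.
have pE : p ^+ 2 = q * r by case: qr_or => // /eqP; rewrite (negPf qr).
have rE : r ^+ 2 = p * q.
  case: pq_or => // pq; case/eqP: qr; apply: (aux _ _ q0 r0).
  by rewrite -{1}pq pE mulrC.
have pr : p = r.
  apply: (pexpIrn (isT : (0 < 3)%N)); rewrite ?nnegrE ?ltW//.
  by rewrite exprSr pE exprSr rE; ring.
by case/eqP: qr; rewrite -pr; apply/esym/(aux _ _ p0 q0); rewrite pE pr.
Qed.

(** Unit vectors with sum zero are at angles of 120 degrees. *)
Let unit_triple u v w : modulus u = 1 -> modulus v = 1 -> modulus w = 1 ->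
  u + v + w = 0 -> u ^+ 2 + u * v + v ^+ 2 = 0.
Proof.
move=> u1 v1 w1 uvw.
have conjV (x : R[i]) : modulus x = 1 -> x * x^* = 1.
  by move=> x1; rewrite -sqr_modulus x1 expr1n.
have uu := conjV _ u1; have vv := conjV _ v1.
have : (u + v) * (u + v)^* = 1.
  by rewrite -(conjV _ w1) (_ : w = - (u + v)) ?rmorphN/= ?mulrNN//; apply/eqP;
    rewrite -addr_eq0 addrC uvw.
rewrite rmorphD/= mulrDl !mulrDr uu vv => E.
transitivity (u ^+ 2 * (v * v^*) + u * v + v ^+ 2 * (u * u^*)).
  by rewrite uu vv !mulr1.
transitivity (u * v * (1 + u * v^* + (v * u^* + 1) - 1)); first by ring.
by rewrite E subrr mulr0.
Qed.

(** The three expressions [1/(A - B) + 1/(A - C)] add up to zero, hence so do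
    the unit vectors [|A|/A], [|B|/B], [|C|/C]: the directions are those of the
    cube roots of unity, and [cube_root_weights] compares the moduli. *)
Let nonzero_triple A B C kappa : kappa != 0 ->
  A != B -> B != C -> C != A -> A != 0 -> B != 0 -> C != 0 ->
  A * ((A - B)^-1 + (A - C)^-1) = (kappa * modulus A)%:C ->
  B * ((B - C)^-1 + (B - A)^-1) = (kappa * modulus B)%:C ->
  C * ((C - A)^-1 + (C - B)^-1) = (kappa * modulus C)%:C ->
  A + B + C = 0 /\ A * B + B * C + C * A = 0.
Proof.
move=> k0 AB BC CA A0 B0 C0 EA EB EC.
set p := modulus A in EA *; set q := modulus B in EB *; set r := modulus C in EC *.
have p0 : 0 < p by rewrite modulus_gt0.
have q0 : 0 < q by rewrite modulus_gt0.
have r0 : 0 < r by rewrite modulus_gt0.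
pose u := p%:C / A; pose v := q%:C / B; pose w := r%:C / C.
have unit x : x != 0 -> modulus ((modulus x)%:C / x) = 1.
  by move=> x0; rewrite modulusM modulusV modulus_real ?modulus_ge0// divff// modulus_eq0.
have u1 : modulus u = 1 by exact: unit.
have v1 : modulus v = 1 by exact: unit.
have w1 : modulus w = 1 by exact: unit.
have AB' : A - B != 0 by rewrite subr_eq0.
have BC' : B - C != 0 by rewrite subr_eq0.
have CA' : C - A != 0 by rewrite subr_eq0.
have BA' : B - A != 0 by rewrite subr_eq0 eq_sym.
have CB' : C - B != 0 by rewrite subr_eq0 eq_sym.
have AC' : A - C != 0 by rewrite subr_eq0 eq_sym.
have uvw : u + v + w = 0.
  have kC0 : kappa%:C != 0 :> R[i] by rewrite fmorph_eq0.
  apply: (mulfI kC0); rewrite mulr0 !mulrDr /u /v /w !mulrA -!rmorphM/= -EA -EB -EC.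
  by field; rewrite A0 B0 C0 AB' BA' BC' CB' CA' AC'.
set zeta := u / v.
have u0 : u != 0 by rewrite -modulus_eq0 u1 oner_eq0.
have v0 : v != 0 by rewrite -modulus_eq0 v1 oner_eq0.
have w0 : w != 0 by rewrite -modulus_eq0 w1 oner_eq0.
have zeta3 : zeta ^+ 2 + zeta + 1 = 0.
  transitivity ((u ^+ 2 + u * v + v ^+ 2) / v ^+ 2).
    by rewrite /zeta; field.
  by rewrite (unit_triple u1 v1 w1 uvw) mul0r.
have z3 : zeta ^+ 3 = 1.
  have : (zeta - 1) * (zeta ^+ 2 + zeta + 1) = 0 by rewrite zeta3 mulr0.
  by move=> h; apply/eqP; rewrite -subr_eq0; apply/eqP; rewrite -h; ring.
have zeta0 : zeta != 0 by rewrite mulf_neq0 ?invr_eq0.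
have z2 : zeta ^+ 2 = u / w.
  have -> : w = - (u + v) by apply/eqP; rewrite -addr_eq0 addrC uvw.
  have uv0 : u + v != 0.
    by rewrite (_ : u + v = - w) ?oppr_eq0//; apply/eqP; rewrite -addr_eq0 uvw.
  have := unit_triple u1 v1 w1 uvw => uvE.
  apply/eqP; rewrite -subr_eq0; apply/eqP.
  transitivity (u * (u ^+ 2 + u * v + v ^+ 2) / (v ^+ 2 * (u + v))).
    by rewrite /zeta; field; rewrite uv0.
  by rewrite uvE mulr0 mul0r.
have toC (x : R) : 0 < x -> x%:C != 0 :> R[i].
  by move=> x0; rewrite fmorph_eq0 gt_eqF.
have pC := toC _ p0; have qC := toC _ q0; have rC := toC _ r0.
have AE : A = p%:C / u by rewrite /u; field; rewrite A0 pC.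
have BE : B = q%:C * zeta / u by rewrite /zeta /u /v; field; rewrite B0 A0 pC qC.
have CE : C = r%:C * zeta ^+ 2 / u.
  have CE : C = r%:C / w by rewrite /w; field; rewrite C0 rC.
  by rewrite {1}CE z2; field; rewrite u0 w0.
have cancel_pos (x : R) (y : R[i]) : 0 < x -> x%:C * y = (kappa * x)%:C ->
    y = kappa%:C.
  by move=> x0 E; apply: (mulfI (toC x x0)); rewrite E rmorphM mulrC.
have weight1 := @cube_root_weights zeta p q r kappa zeta3 p0 q0 r0.
have weight2 := @cube_root_weights zeta q r p kappa zeta3 q0 r0 p0.
have weight3 := @cube_root_weights zeta r p q kappa zeta3 r0 p0 q0.
have zV : zeta ^+ 2 = zeta^-1 by apply: (mulIf zeta0); rewrite mulVf// -exprSr.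
have sub0 (x y : R[i]) : x / u - y / u != 0 -> x - y != 0.
  by rewrite -mulrBl mulf_eq0 negb_or => /andP[].
have factor (c x y : R[i]) : x != 0 -> x = c * y -> y != 0.
  by move=> x0 xE; apply: contra x0 => /eqP y0; rewrite xE y0 mulr0.
have [] := geometric_means p0 q0 r0.
- apply: weight1; apply: (cancel_pos p) => //; rewrite -EA AE BE CE.
  move: AB' AC'; rewrite AE BE CE => /sub0 d1 /sub0 d2.
  by field; rewrite d1 d2 u0 ?zeta0.
- apply: weight2; apply: (cancel_pos q) => //; rewrite -EB AE BE CE [in LHS]zV.
  move: BC' BA'; rewrite AE BE CE => /sub0 d1 /sub0 d2.
  have d3 : q%:C - r%:C * zeta != 0 by apply: (@factor zeta _ _ d1); ring.
  by field; rewrite d1 d2 d3 u0 ?zeta0.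
- apply: weight3; apply: (cancel_pos r) => //; rewrite -EC AE BE CE [in LHS]zV.
  rewrite (_ : r%:C - p%:C * zeta = r%:C - p%:C / zeta ^+ 2); last first.
    by congr (_ - _ * _); rewrite zV invrK.
  move: CA' CB'; rewrite AE BE CE => /sub0 d1 /sub0 d2.
  have d3 : r%:C * zeta - q%:C != 0 by apply: (@factor zeta _ _ d2); ring.
  by field; rewrite d1 d2 d3 u0 ?zeta0.
move=> pq qr; rewrite AE BE CE -qr -pq; split.
  transitivity (p%:C / u * (zeta ^+ 2 + zeta + 1)); first by ring.
  by rewrite zeta3 mulr0.
transitivity (p%:C ^+ 2 / u ^+ 2 * (zeta ^+ 2 + zeta + zeta ^+ 3)).
  by field.
by rewrite z3 zeta3 mulr0.
Qed.

(** The case [C = 0], where [B / A] is a real number [t] subject to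
    [1 - 2 t = |t| (2 - t)]. *)
Let zero_triple A B kappa :
  A != B -> A != 0 -> B != 0 ->
  A * ((A - B)^-1 + A^-1) = (kappa * modulus A)%:C ->
  B * (B^-1 + (B - A)^-1) = (kappa * modulus B)%:C ->
  A = - B \/ A ^+ 2 + B ^+ 2 = 4 * (A * B).
Proof.
move=> AB A0 B0 EA EB.
have AB' : A - B != 0 by rewrite subr_eq0.
have BA' : B - A != 0 by rewrite subr_eq0 eq_sym.
set p := modulus A in EA *.
have p0 : 0 < p by rewrite modulus_gt0.
(* The equation for [A] makes [A / (A - B)] real, hence [B / A] as well. *)
pose x := kappa * p - 1.
have xE : A / (A - B) = x%:C by rewrite rmorphB/= -EA; field; rewrite A0 AB'.
have x0 : x != 0.
  by rewrite -(fmorph_eq0 (real_complex R))/= -xE mulf_neq0 ?invr_eq0.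
have xC0 : x%:C != 0 :> R[i] by rewrite fmorph_eq0.
pose t := (x - 1) / x.
have BE : B = t%:C * A.
  rewrite rmorphM fmorphV rmorphB/= -xE; field.
  by rewrite AB' A0.
have t0 : t != 0.
  by apply/eqP => t0; case/eqP: B0; rewrite BE t0 mul0r.
have t1 : 1 - t != 0.
  apply/eqP => t1; case/eqP: AB'; rewrite BE -[X in X - _]mul1r -mulrBl.
  by rewrite -(rmorph1 (real_complex R)) -rmorphB t1 rmorph0 mul0r.
have t1C : 1 - t%:C != 0 :> R[i].
  by rewrite -(rmorph1 (real_complex R)) -rmorphB fmorph_eq0.
have x_t : x = (1 - t)^-1.
  by apply/(mulfI t1); rewrite divff// /t; field.
have kp : kappa * p = (2 - t) / (1 - t).
  have -> : kappa * p = x + 1 by rewrite /x; ring.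
  by rewrite x_t; field.
have tE : 1 - 2 * t = `|t| * (2 - t).
  have : ((1 - 2 * t) / (1 - t))%:C = (`|t| * (2 - t) / (1 - t))%:C :> R[i].
    have -> : `|t| * (2 - t) / (1 - t) = kappa * modulus B.
      by rewrite BE modulusM modulusR -/p mulrCA kp mulrA.
    rewrite -EB.
    rewrite rmorphM fmorphV/= BE; field.
    by rewrite -BE BA' A0 fmorph_eq0 t0 t1C.
  by move/complexI => /(divIf t1).
have [t_ge0|t_lt0] := leP 0 t.
  right; move: tE; rewrite ger0_norm// => tE.
  transitivity ((1 + t ^+ 2)%:C * A ^+ 2); first by rewrite BE; ring.
  rewrite (_ : 1 + t ^+ 2 = 4 * t); last by lra.
  by rewrite BE; ring.
left; move: tE; rewrite ltr0_norm// => tE.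
have : (t - 1) * (t + 1) == 0 by apply/eqP; lra.
rewrite mulf_eq0 -oppr_eq0 opprB (negPf t1)/= => /eqP tN1.
by rewrite BE (_ : t = -1) ?rmorphN1 ?mulN1r ?opprK//; lra.
Qed.

(** The quotient of the two nonzero numbers is [2 + sqrt 3] or its inverse
    [2 - sqrt 3]. *)
Definition one_zero_two_aligned A B C :=
  [\/ C = 0 /\ A ^+ 2 + B ^+ 2 = 4 * (A * B),
      A = 0 /\ B ^+ 2 + C ^+ 2 = 4 * (B * C)
    | B = 0 /\ C ^+ 2 + A ^+ 2 = 4 * (C * A)].

Lemma triple_classification A B C kappa : kappa != 0 ->
  A != B -> B != C -> C != A ->
  A * ((A - B)^-1 + (A - C)^-1) = (kappa * modulus A)%:C ->
  B * ((B - C)^-1 + (B - A)^-1) = (kappa * modulus B)%:C ->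
  C * ((C - A)^-1 + (C - B)^-1) = (kappa * modulus C)%:C ->
  [\/ one_zero_two_opposite A B C, one_zero_two_aligned A B C
    | A + B + C = 0 /\ A * B + B * C + C * A = 0].
Proof.
move=> k0 AB BC CA EA EB EC.
have [A0|A0] := eqVneq A 0.
  move: EB EC; rewrite A0 subr0 subr0 => EB EC.
  rewrite A0 in AB CA; rewrite eq_sym in AB.
  by have [h|h] := zero_triple BC AB CA EB EC; [constructor 1|constructor 2];
    constructor 2.
have [B0|B0] := eqVneq B 0.
  move: EC EA; rewrite B0 !subr0 => EC EA.
  rewrite B0 in BC; rewrite eq_sym in BC.
  by have [h|h] := zero_triple CA BC A0 EC EA; [constructor 1|constructor 2];
    constructor 3.
have [C0|C0] := eqVneq C 0.
  move: EA EB; rewrite C0 !subr0 => EA EB.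
  by have [h|h] := zero_triple AB A0 B0 EA EB; [constructor 1|constructor 2];
    constructor 1.
by constructor 3; exact: nonzero_triple EA EB EC.
Qed.

End TripleEquations.

(** * Character coordinates of a quadruple *)
Section Coordinates.
Variable R : realType.
Implicit Types (Gamma I : R) (zc a b c : R[i]) (z : quadruple R).

Definition v0 : 'I_4 := @Ordinal 4 0 isT.
Definition v1 : 'I_4 := @Ordinal 4 1 isT.
Definition v2 : 'I_4 := @Ordinal 4 2 isT.
Definition v3 : 'I_4 := @Ordinal 4 3 isT.

Lemma ord4_ind (P : 'I_4 -> Prop) :
  P v0 -> P v1 -> P v2 -> P v3 -> forall j, P j.
Proof.
move=> P0 P1 P2 P3 [[|[|[|[|//]]]] lt_j].
- by rewrite (_ : Ordinal _ = v0)//; exact: val_inj.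
- by rewrite (_ : Ordinal _ = v1)//; exact: val_inj.
- by rewrite (_ : Ordinal _ = v2)//; exact: val_inj.
- by rewrite (_ : Ordinal _ = v3)//; exact: val_inj.
Qed.

Lemma sum4E (V : nmodType) (f : 'I_4 -> V) :
  \sum_(i < 4) f i = f v0 + f v1 + f v2 + f v3.
Proof.
rewrite !big_ord_recl big_ord0 addr0 !addrA.
by congr (f _ + f _ + f _ + f _); exact: val_inj.
Qed.

Lemma sum_pairsE (f : 'I_4 -> 'I_4 -> R) :
  \sum_(i < 4) \sum_(j < 4 | (i < j)%N) f i j
    = f v0 v1 + f v0 v2 + f v0 v3 + f v1 v2 + f v1 v3 + f v2 v3.
Proof.
under eq_bigr do rewrite big_mkcond sum4E/=.
by rewrite sum4E/=; ring.
Qed.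

(** The sum over unordered pairs, in a form where relabeling is a reindexing. *)
Lemma sum_pairs_sym (f : 'I_4 -> 'I_4 -> R) :
  (forall i j, f i j = f j i) -> (forall i, f i i = 0) ->
  \sum_(i < 4) \sum_(j < 4 | (i < j)%N) f i j
    = 2^-1 * \sum_(i < 4) \sum_(j < 4) f i j.
Proof.
move=> f_sym f0; rewrite sum_pairsE; under eq_bigr do rewrite sum4E.
rewrite sum4E !f0 (f_sym v1 v0) (f_sym v2 v0) (f_sym v3 v0) (f_sym v2 v1).
by rewrite (f_sym v3 v1) (f_sym v3 v2); field.
Qed.

Lemma quadruple_eq z z' : z v0 = z' v0 -> z v1 = z' v1 -> z v2 = z' v2 ->
  z v3 = z' v3 -> z = z'.
Proof. by move=> e0 e1 e2 e3; apply/funext; exact: ord4_ind. Qed.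

(** The sign patterns are the three nontrivial characters of the Klein
    four-group of double transpositions of the indices. *)
Definition quad zc a b c : quadruple R := fun j =>
  zc + nth 0 [:: a + b + c; a - b - c; - a + b - c; - a - b + c] j / 4.

Lemma quad_surj zc z : 4^-1 * \sum_(j < 4) z j = zc ->
  exists a b c, z = quad zc a b c.
Proof.
rewrite sum4E => zcE; exists (z v0 + z v1 - z v2 - z v3),
  (z v0 - z v1 + z v2 - z v3), (z v0 - z v1 - z v2 + z v3).
by apply: quadruple_eq; rewrite /quad -zcE/=; field.
Qed.

Lemma quadB zc a b c :
  let z := quad zc a b c in
  [/\ z v0 - z v1 = (b + c) / 2, z v0 - z v2 = (a + c) / 2
    & z v0 - z v3 = (a + b) / 2] /\
  [/\ z v1 - z v2 = (a - b) / 2, z v1 - z v3 = (a - c) / 2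
    & z v2 - z v3 = (b - c) / 2].
Proof. by rewrite /quad/=; split; split; field. Qed.

Definition disc3 a b c := (a ^+ 2 - b ^+ 2) * (b ^+ 2 - c ^+ 2) * (c ^+ 2 - a ^+ 2).

Lemma quad_config zc a b c : configuration (quad zc a b c) <-> disc3 a b c != 0.
Proof.
have [[e01 e02 e03] [e12 e13 e23]] := quadB zc a b c.
have half0 (x y w : R[i]) : x - y = w / 2 -> (x != y) = (w != 0).
  by move=> xyw; rewrite -subr_eq0 xyw mulf_eq0 invr_eq0 pnatr_eq0 orbF.
move/half0: e01 => e01; move/half0: e02 => e02; move/half0: e03 => e03.
move/half0: e12 => e12; move/half0: e13 => e13; move/half0: e23 => e23.
have -> : disc3 a b c = - ((b + c) * (a + c) * (a + b) * (a - b) * (a - c)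
   * (b - c)) by rewrite /disc3; ring.
rewrite oppr_eq0; split=> [zconf|].
  have n01 := zconf v0 v1 isT; rewrite e01 in n01.
  have n02 := zconf v0 v2 isT; rewrite e02 in n02.
  have n03 := zconf v0 v3 isT; rewrite e03 in n03.
  have n12 := zconf v1 v2 isT; rewrite e12 in n12.
  have n13 := zconf v1 v3 isT; rewrite e13 in n13.
  have n23 := zconf v2 v3 isT; rewrite e23 in n23.
  by rewrite !mulf_neq0.
rewrite !mulf_eq0 !negb_or => /andP[/andP[/andP[/andP[/andP[n01 n02] n03] n12]]].
move=> n13 n23; rewrite -e01 in n01; rewrite -e02 in n02; rewrite -e03 in n03.
rewrite -e12 in n12; rewrite -e13 in n13; rewrite -e23 in n23.
by apply: ord4_ind; apply: ord4_ind => // _; rewrite // eq_sym.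
Qed.

Lemma hamiltonianE Gamma z : hamiltonian Gamma z = - (Gamma ^+ 2 / (2 * pi)) *
  \sum_(i < 4) \sum_(j < 4 | (i < j)%N) ln (modulus (z i - z j)).
Proof. by []. Qed.

Lemma ln_modulusM (v w : R[i]) : v != 0 -> w != 0 ->
  ln (modulus (v * w)) = ln (modulus v) + ln (modulus w).
Proof. by move=> v0 w0; rewrite modulusM lnM// posrE modulus_gt0. Qed.

(** The six differences multiply to [disc3 a b c / 64] up to sign. *)
Lemma hamiltonian_quad Gamma zc a b c : configuration (quad zc a b c) ->
  hamiltonian Gamma (quad zc a b c)
    = - (Gamma ^+ 2 / (2 * pi)) * (ln (modulus (disc3 a b c)) - ln 64).
Proof.
move=> zconf; rewrite hamiltonianE sum_pairsE; congr (_ * _).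
have [[e01 e02 e03] [e12 e13 e23]] := quadB zc a b c.
set z := quad zc a b c in zconf e01 e02 e03 e12 e13 e23 *.
have nz i j : i != j -> z i - z j != 0 by rewrite subr_eq0; exact: zconf.
rewrite -!ln_modulusM ?mulf_neq0 ?nz//.
have -> : disc3 a b c = (z v0 - z v1) * (z v0 - z v2) * (z v0 - z v3)
    * (z v1 - z v2) * (z v1 - z v3) * (z v2 - z v3) * (- 64)%:C.
  by rewrite e01 e02 e03 e12 e13 e23 /disc3; field.
rewrite [in RHS]ln_modulusM ?mulf_neq0 ?nz ?fmorph_eq0 ?oppr_eq0//.
by rewrite modulusR normrN ger0_norm ?addrK.
Qed.

Lemma quad_impulse zc a b c :
  \sum_(j < 4) modulus (quad zc a b c j - zc) ^+ 2
    = (modulus a ^+ 2 + modulus b ^+ 2 + modulus c ^+ 2) / 4.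
Proof.
apply: complexI; rewrite sum4E !rmorphD/= !sqr_modulus rmorphM fmorphV !rmorphD/= !sqr_modulus.
by rewrite /quad/= ![zc + _]addrC !addrK; field.
Qed.

Lemma quad_center zc a b c : 4^-1 * \sum_(j < 4) quad zc a b c j = zc.
Proof. by rewrite sum4E /quad/=; field. Qed.

Lemma phase_space_quad zc I a b c : phase_space zc I (quad zc a b c) <->
  modulus a ^+ 2 + modulus b ^+ 2 + modulus c ^+ 2 = 4 * I /\ disc3 a b c != 0.
Proof.
rewrite -(quad_config zc); split=> [[_ IE zconf]|[abc zconf]]; split=> //.
- by rewrite -IE quad_impulse; field.
- exact: quad_center.
- by rewrite [LHS]quad_impulse abc; field.
Qed.

Lemma phase_space_quadP zc I z : phase_space zc I z ->
  exists a b c, [/\ z = quad zc a b c,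
    modulus a ^+ 2 + modulus b ^+ 2 + modulus c ^+ 2 = 4 * I & disc3 a b c != 0].
Proof.
move=> zI; have [/quad_surj[a [b [c zE]]] _ _] := zI.
by move: zI; rewrite zE => /phase_space_quad[]; exists a, b, c.
Qed.

(** Vortices of equal intensities can be relabeled at will; with
    [hamiltonian_perm], this is what transports extremality and criticality. *)
Lemma phase_space_perm zc I z (sigma : 'S_4) :
  phase_space zc I (z \o sigma) <-> phase_space zc I z.
Proof.
have sumE (V : nmodType) (f : 'I_4 -> V) : \sum_j f (sigma j) = \sum_j f j.
  by rewrite [RHS](reindex_inj (@perm_inj _ sigma)).
have -> : phase_space zc I (z \o sigma) <->
    [/\ 4^-1 * \sum_(j < 4) z j = zc,
      \sum_(j < 4) modulus (z j - zc) ^+ 2 = I & configuration (z \o sigma)].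
  by rewrite -(sumE _ z) -(sumE _ (fun j => modulus (z j - zc) ^+ 2)).
split=> -[zcE IE zconf]; split=> // i j ij; last first.
  by apply: zconf; rewrite (inj_eq perm_inj).
have := zconf ((sigma^-1)%g i) ((sigma^-1)%g j); rewrite /= !permKV; apply.
by rewrite (inj_eq perm_inj).
Qed.

Lemma hamiltonian_perm Gamma z (sigma : 'S_4) :
  hamiltonian Gamma (z \o sigma) = hamiltonian Gamma z.
Proof.
rewrite !hamiltonianE !sum_pairs_sym => [|i j|i|i j|i]; last 4 first.
- by rewrite modulusBC.
- by rewrite subrr modulusR normr0 ln0.
- by rewrite modulusBC.
- by rewrite subrr modulusR normr0 ln0.
congr (_ * (_ * _)); rewrite [RHS](reindex_inj (@perm_inj _ sigma)).
by apply: eq_bigr => i _; rewrite [RHS](reindex_inj (@perm_inj _ sigma)).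
Qed.

End Coordinates.

(** * The three shapes and their rigid motions *)
Section Shapes.
Variable R : realType.
Implicit Types (Gamma I theta t : R) (zc u w g h : R[i]) (z : quadruple R).

Lemma cexpiD theta t : cexpi (theta + t) = cexpi theta * cexpi t.
Proof. by rewrite /cexpi cosD sinD; simpc; congr (_ +i* _); ring. Qed.

Lemma cexpi0 : cexpi 0 = 1 :> R[i].
Proof. by rewrite /cexpi cos0 sin0. Qed.

Lemma modulus_cexpi theta : modulus (cexpi theta) = 1.
Proof. by rewrite /modulus /= cos2Dsin2 sqrtr1. Qed.

Lemma cexpi_surj u : modulus u = 1 -> exists theta, cexpi theta = u.
Proof.
move=> u1; have := sqr_modulusE u; rewrite u1 expr1n; case: u {u1} => x y /= xy.
have x1 : -1 <= x <= 1.
  by rewrite -ler_norml -(@ler_pXn2r _ 2)// ?nnegrE// expr1n real_normK ?num_real//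
    xy lerDl sqr_ge0.
have sinE : sin (acos x) = `|y|.
  rewrite sin_acos//.
  by rewrite (_ : 1 - x ^+ 2 = y ^+ 2) ?sqrtr_sqr//; lra.
have [y0|y0] := leP 0 y.
  by exists (acos x); rewrite /cexpi acosK ?in_itv//= sinE ger0_norm.
exists (- acos x); rewrite /cexpi cosN sinN acosK ?in_itv//= sinE.
by rewrite ltr0_norm// opprK.
Qed.

Lemma cexpi_pi2 : cexpi (pi / 2) = 'i%C :> R[i].
Proof. by rewrite /cexpi cos_pihalf sin_pihalf. Qed.

Lemma cexpi_pi : cexpi pi = -1 :> R[i].
Proof. by rewrite /cexpi cospi sinpi; simpc. Qed.

Definition cube_root : R[i] := cexpi (2 * pi / 3).

Lemma cube_rootE : cube_root ^+ 2 + cube_root + 1 = 0.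
Proof.
have z3 : cube_root ^+ 3 = 1.
  rewrite !exprS expr0 mulr1 /cube_root -!cexpiD.
  rewrite (_ : _ + _ = pi + pi); last by field.
  by rewrite cexpiD cexpi_pi mulrNN mulr1.
have z1 : cube_root - 1 != 0.
  rewrite subr_eq0; apply/eqP => /(congr1 (@complex.Im R)) Im1.
  have sin0 : sin (2 * pi / 3) = 0 :> R by exact: Im1.
  have : 0 < sin (2 * pi / 3) :> R by apply: sin_gt0_pi; have := pi_gt0 R; lra.
  by rewrite sin0 ltxx.
apply: (mulfI z1); rewrite mulr0.
by transitivity (cube_root ^+ 3 - 1); [ring | rewrite z3 subrr].
Qed.

Definition square_shape I : quadruple R := fun j =>
  (2^-1 * Num.sqrt I)%:C * cexpi (pi / 2 * j%:R).

Definition collinear_radius (i : bool) : R :=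
  if i then (2 * Num.sqrt (3 - Num.sqrt 6))^-1
  else (2 * Num.sqrt (3 + Num.sqrt 6))^-1.

Definition collinear_shape I : quadruple R := fun j =>
  (collinear_radius (j < 2)%N * Num.sqrt I)%:C * cexpi (pi * j%:R).

Definition triangle_shape I : quadruple R := fun j =>
  if j == ord0 then 0
  else ((Num.sqrt 3)^-1 * Num.sqrt I)%:C * cexpi (2 * pi / 3 * j.-1%:R).

Definition rigid_motion Gamma I zc (s : quadruple R) t : quadruple R :=
  fun j => zc + cexpi (omega Gamma I * t) * s j.

Lemma square_motionE Gamma zc I :
  square_motion Gamma zc I = rigid_motion Gamma I zc (square_shape I).
Proof.
apply/funext => t; apply/funext => j.
by rewrite /square_motion /rigid_motion /square_shape cexpiD mulrCA.
Qed.

Lemma collinear_motionE Gamma zc I :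
  collinear_motion Gamma zc I = rigid_motion Gamma I zc (collinear_shape I).
Proof.
apply/funext => t; apply/funext => j.
by rewrite /collinear_motion /rigid_motion /collinear_shape cexpiD mulrCA.
Qed.

Lemma triangle_motionE Gamma zc I :
  triangle_motion Gamma zc I = rigid_motion Gamma I zc (triangle_shape I).
Proof.
apply/funext => t; apply/funext => j.
rewrite /triangle_motion /rigid_motion /triangle_shape; case: ifP => _.
  by rewrite mulr0 addr0.
by rewrite cexpiD mulrCA.
Qed.

(** Relabeling and rotation about [zc] by a unit complex number; the angles of
    [transformed] and the time of [position_of] only enter through such a
    number. *)
Definition congruent zc (s z : quadruple R) := exists (sigma : 'S_4) (u : R[i]),
  modulus u = 1 /\ forall j, z (sigma j) = zc + u * s j.

Lemma position_ofP Gamma I zc s z :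
  position_of zc (rigid_motion Gamma I zc s) z <-> congruent zc s z.
Proof.
split=> [[sigma [theta [t E]]]|[sigma [u [u1 E]]]]; exists sigma.
  exists (cexpi (- theta + omega Gamma I * t)); split; first exact: modulus_cexpi.
  move=> j; have := E j; rewrite /transformed /rotation /rigid_motion.
  move/addrI => jE; rewrite cexpiD -mulrA -jE mulrA -cexpiD addNr cexpi0 mul1r.
  by rewrite addrC subrK.
have [theta thetaE] := cexpi_surj u1; exists (- theta), 0 => j.
rewrite /transformed /rotation /rigid_motion mulr0 E [zc + u * _]addrC addrK.
by rewrite -thetaE mulrA -cexpiD addNr.
Qed.

Lemma perm_of_indices (i0 i1 i2 i3 : 'I_4) : uniq [:: i0; i1; i2; i3] ->
  exists sigma : 'S_4,
    [/\ sigma v0 = i0, sigma v1 = i1, sigma v2 = i2 & sigma v3 = i3].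
Proof.
move=> uniq_i; pose f (j : 'I_4) := nth i0 [:: i0; i1; i2; i3] j.
have f_inj : injective f.
  by move=> j k /eqP; rewrite nth_uniq// => /eqP/val_inj.
by exists (perm f_inj); rewrite !permE.
Qed.

End Shapes.

(** * Recognizing the shapes up to relabeling and rotation *)
Section Recognition.
Variable R : realType.
Implicit Types (I x : R) (zc u g h a b c : R[i]) (z s : quadruple R).
Implicit Types i : 'I_4.

Lemma congruent_indices zc s z i0 i1 i2 i3 u :
  uniq [:: i0; i1; i2; i3] -> modulus u = 1 ->
  z i0 = zc + u * s v0 -> z i1 = zc + u * s v1 ->
  z i2 = zc + u * s v2 -> z i3 = zc + u * s v3 -> congruent zc s z.
Proof.
move=> /perm_of_indices[sigma [s0 s1 s2 s3]] u1 e0 e1 e2 e3.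
by exists sigma, u; split=> //; apply: ord4_ind; rewrite ?s0 ?s1 ?s2 ?s3.
Qed.

Lemma sum4_indices (V : nmodType) (f : 'I_4 -> V) i0 i1 i2 i3 :
  uniq [:: i0; i1; i2; i3] -> \sum_j f j = f i0 + f i1 + f i2 + f i3.
Proof.
move=> /perm_of_indices[sigma [<- <- <- <-]].
by rewrite (reindex_inj (@perm_inj _ sigma)) sum4E.
Qed.

Lemma cexpiMn x n : cexpi (x * n%:R) = cexpi x ^+ n.
Proof.
elim: n => [|n IHn]; first by rewrite mulr0 cexpi0.
by rewrite -natr1 mulrDr mulr1 cexpiD IHn exprSr.
Qed.

Lemma mulii : 'i%C * 'i%C = -1 :> R[i].
Proof. by rewrite -expr2 sqr_i. Qed.

Lemma square_shapeE I : let r := (2^-1 * Num.sqrt I)%:C in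
  [/\ square_shape I v0 = r, square_shape I v1 = r * 'i%C,
      square_shape I v2 = - r & square_shape I v3 = - (r * 'i%C)].
Proof.
move=> r; rewrite /square_shape !cexpiMn cexpi_pi2 -/r /= !exprS expr0 mulr1 mulii.
by clearbody r; split; ring.
Qed.

Lemma collinear_shapeE I :
  let r1 := (collinear_radius R true * Num.sqrt I)%:C in
  let r2 := (collinear_radius R false * Num.sqrt I)%:C in
  [/\ collinear_shape I v0 = r1, collinear_shape I v1 = - r1,
      collinear_shape I v2 = r2 & collinear_shape I v3 = - r2].
Proof.
move=> r1 r2; rewrite /collinear_shape !cexpiMn cexpi_pi -/r1 -/r2 /=.
by clearbody r1 r2; rewrite !exprS expr0 mulr1; split; ring.
Qed.

Lemma triangle_shapeE I : let r := ((Num.sqrt 3)^-1 * Num.sqrt I)%:C in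
  [/\ triangle_shape I v0 = 0, triangle_shape I v1 = r,
      triangle_shape I v2 = r * cube_root R
    & triangle_shape I v3 = r * cube_root R ^+ 2].
Proof.
by rewrite /triangle_shape /= !cexpiMn expr0 expr1 mulr1.
Qed.

(** Squared radii without square roots in denominators, because
    [(3 - sqrt 6) (3 + sqrt 6) = 3]. *)
Lemma sqr_collinear_radius : let r := collinear_radius R in
  [/\ 0 < r true, 0 < r false,
      r true ^+ 2 = (3 + Num.sqrt 6) / 12
    & r false ^+ 2 = (3 - Num.sqrt 6) / 12].
Proof.
set s := Num.sqrt 6; have s0 : 0 <= s by exact: sqrtr_ge0.
have s6 : s ^+ 2 = 6 by rewrite sqr_sqrtr.
have s3 : s < 3 by rewrite -(@ltr_pXn2r _ 2) ?nnegrE// s6; lra.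
have pos : 0 < 3 - s by rewrite subr_gt0.
have pos' : 0 < 3 + s by lra.
have conj1 : 3 + s = 3 / (3 - s).
  apply: (mulIf (lt0r_neq0 pos)); rewrite divfK ?lt0r_neq0//.
  by transitivity (9 - s ^+ 2); [ring | rewrite s6; ring].
have conj2 : 3 - s = 3 / (3 + s).
  apply: (mulIf (lt0r_neq0 pos')); rewrite divfK ?lt0r_neq0//.
  by transitivity (9 - s ^+ 2); [ring | rewrite s6; ring].
split; rewrite /= -/s ?invr_gt0 ?mulr_gt0 ?sqrtr_gt0// exprVn exprMn
  sqr_sqrtr ?ltW//.
- by rewrite conj1; field; rewrite lt0r_neq0.
- by rewrite conj2; field; rewrite lt0r_neq0.
Qed.

Lemma antipodal_impulse zc I z i0 i1 i2 i3 g h : phase_space zc I z ->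
  uniq [:: i0; i1; i2; i3] -> z i0 = zc + g -> z i1 = zc - g ->
  z i2 = zc + h -> z i3 = zc - h -> 2 * (modulus g ^+ 2 + modulus h ^+ 2) = I.
Proof.
move=> [_ <- _] uniq_i e0 e1 e2 e3; rewrite (sum4_indices _ uniq_i).
rewrite e0 e1 e2 e3 ![zc + _]addrC !addrK -!/(modulus _) !modulusN; ring.
Qed.

(** Two pairs of antipodal points at [g] and [h] form a square when
    [h = +-i g]; the sign decides the cyclic order of the vertices. *)
Lemma antipodal_square zc I z i0 i1 i2 i3 g h : 0 < I -> phase_space zc I z ->
  uniq [:: i0; i1; i2; i3] -> z i0 = zc + g -> z i1 = zc - g ->
  z i2 = zc + h -> z i3 = zc - h -> g ^+ 2 + h ^+ 2 = 0 ->
  congruent zc (square_shape I) z.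
Proof.
move=> I0 zI uniq_i e0 e1 e2 e3 gh.
have := antipodal_impulse zI uniq_i e0 e1 e2 e3.
have -> : modulus h ^+ 2 = modulus g ^+ 2.
  by rewrite -!modulusX -modulusN; congr modulus; apply/eqP; rewrite eq_sym
    -addr_eq0 gh.
move=> gI; have [s0 s1 s2 s3] := square_shapeE I.
set r := 2^-1 * Num.sqrt I in s0 s1 s2 s3.
have r0 : 0 < r by rewrite mulr_gt0// sqrtr_gt0.
have rC : r%:C != 0 :> R[i] by rewrite fmorph_eq0 gt_eqF.
have gr : modulus g = r.
  apply: (pexpIrn (isT : (0 < 2)%N)); rewrite ?nnegrE ?modulus_ge0 ?ltW//.
  by rewrite /r exprMn sqr_sqrtr ?ltW// -gI; field.
have u1 : modulus (g / r%:C) = 1.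
  by rewrite modulusM modulusV gr modulus_real ?ltW// divff// gt_eqF.
have : (h - 'i%C * g) * (h + 'i%C * g) == 0.
  rewrite -subr_sqr exprMn sqr_i; apply/eqP; rewrite -gh; ring.
rewrite mulf_eq0 subr_eq0 addr_eq0 => /orP[/eqP hE|/eqP hE].
- have uniq_j : uniq [:: i0; i2; i1; i3].
    by move: uniq_i; rewrite /= !inE (eq_sym i2 i1); do 6!case: (_ == _).
  by apply: (congruent_indices uniq_j u1);
    rewrite ?s0 ?s1 ?s2 ?s3 ?e0 ?e1 ?e2 ?e3 ?hE; field.
- have uniq_j : uniq [:: i0; i3; i1; i2].
    by move: uniq_i; rewrite /= !inE (eq_sym i3 i1) (eq_sym i3 i2);
      do 6!case: (_ == _).
  by apply: (congruent_indices uniq_j u1);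
    rewrite ?s0 ?s1 ?s2 ?s3 ?e0 ?e1 ?e2 ?e3 ?hE; field.
Qed.

(** The equation factors as
    [(h^2 - (5 - 2 sqrt 6) g^2) (h^2 - (5 + 2 sqrt 6) g^2) = 0] and
    [5 - 2 sqrt 6] is the squared ratio of the two radii; the second factor is
    the first one with the two pairs exchanged. *)
Lemma antipodal_collinear zc I z i0 i1 i2 i3 g h : 0 < I -> phase_space zc I z ->
  uniq [:: i0; i1; i2; i3] -> z i0 = zc + g -> z i1 = zc - g ->
  z i2 = zc + h -> z i3 = zc - h ->
  g ^+ 4 + h ^+ 4 = 10 * (g ^+ 2 * h ^+ 2) ->
  congruent zc (collinear_shape I) z.
Proof.
pose s := Num.sqrt 6 : R.
have s6 : s ^+ 2 = 6 by rewrite sqr_sqrtr.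
have [r1_gt0 r2_gt0 r1E r2E] := sqr_collinear_radius; rewrite -/s in r1E r2E.
set r1 := collinear_radius R true in r1_gt0 r1E.
set r2 := collinear_radius R false in r2_gt0 r2E.
have s0 : 0 <= s by exact: sqrtr_ge0.
have s3 : s < 3 by rewrite -(@ltr_pXn2r _ 2) ?nnegrE// s6; lra.
have r12 : r2 ^+ 2 = (5 - 2 * s) * r1 ^+ 2.
  rewrite r1E r2E; transitivity ((15 - s - 2 * s ^+ 2) / 12).
    by rewrite s6; field.
  by field.
wlog hg : i0 i1 i2 i3 g h / h ^+ 2 = (5 - 2 * s)%:C * g ^+ 2.
  move=> wlog_hg I0 zI uniq_i e0 e1 e2 e3 gh.
  have : (h ^+ 2 - (5 - 2 * s)%:C * g ^+ 2) * (h ^+ 2 - (5 + 2 * s)%:C * g ^+ 2)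
      = 0.
    transitivity (h ^+ 4 + (25 - 4 * s ^+ 2)%:C * g ^+ 4
      - 10 * (g ^+ 2 * h ^+ 2)); first by ring.
    by rewrite s6 -gh; ring.
  move/eqP; rewrite mulf_eq0 !subr_eq0 => /orP[/eqP hE|/eqP hE].
    exact: (wlog_hg i0 i1 i2 i3 g h).
  apply: (wlog_hg i2 i3 i0 i1 h g) => //.
  - transitivity ((25 - 4 * s ^+ 2)%:C * g ^+ 2); first by rewrite s6; ring.
    by rewrite hE; ring.
  - move: uniq_i; rewrite /= !inE (eq_sym i2 i0) (eq_sym i2 i1) (eq_sym i3 i0)
      (eq_sym i3 i1); by do 6!case: (_ == _).
  - by rewrite addrC gh; ring.
move=> I0 zI uniq_i e0 e1 e2 e3 _.
have := antipodal_impulse zI uniq_i e0 e1 e2 e3.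
have -> : modulus h ^+ 2 = (5 - 2 * s) * modulus g ^+ 2.
  rewrite -!modulusX hg modulusM modulus_real//.
  by have := @ler_pXn2r R 2 isT (2 * s) 5; rewrite !nnegrE exprMn s6; lra.
move=> gI; have [s0' s1 s2 s3'] := collinear_shapeE I.
have sI0 : 0 < Num.sqrt I by rewrite sqrtr_gt0.
have gr : modulus g = r1 * Num.sqrt I.
  apply: (pexpIrn (isT : (0 < 2)%N)).
  - by rewrite nnegrE modulus_ge0.
  - by rewrite nnegrE mulr_ge0 ?ltW.
  rewrite exprMn sqr_sqrtr ?ltW// r1E -gI.
  by transitivity ((9 - s ^+ 2) / 3 * modulus g ^+ 2); [rewrite s6|]; field.
have sIC : (Num.sqrt I)%:C != 0 :> R[i] by rewrite fmorph_eq0 gt_eqF.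
have r1C : r1%:C != 0 :> R[i] by rewrite fmorph_eq0 gt_eqF.
have u1 : modulus (g / (r1 * Num.sqrt I)%:C) = 1.
  by rewrite modulusM modulusV gr modulus_real ?mulr_ge0 ?ltW// divff// gt_eqF//
    mulr_gt0.
have : (r1%:C * h - r2%:C * g) * (r1%:C * h + r2%:C * g) == 0.
  apply/eqP; rewrite -subr_sqr !exprMn hg -!rmorphXn/= r12; ring.
rewrite mulf_eq0 subr_eq0 addr_eq0 => /orP[/eqP hE|/eqP hE].
- have {}hE : h = r2%:C * g / r1%:C by rewrite -hE; field.
  by apply: (congruent_indices uniq_i u1);
    rewrite ?s0' ?s1 ?s2 ?s3' ?e0 ?e1 ?e2 ?e3 ?hE; field; rewrite r1C sIC.
- have {}hE : h = - (r2%:C * g / r1%:C) by rewrite -mulNr -hE; field.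
  have uniq_j : uniq [:: i0; i1; i3; i2].
    by move: uniq_i; rewrite /= !inE (eq_sym i3 i2); do 6!case: (_ == _).
  by apply: (congruent_indices uniq_j u1);
    rewrite ?s0' ?s1 ?s2 ?s3' ?e0 ?e1 ?e2 ?e3 ?hE; field; rewrite r1C sIC.
Qed.

(** The quadratic equation says that [h] is [g] rotated by a third of a turn, in
    one direction or the other; the last vertex is then determined. *)
Lemma centered_triangle zc I z i0 i1 i2 i3 g h : 0 < I -> phase_space zc I z ->
  uniq [:: i0; i1; i2; i3] -> z i0 = zc -> z i1 = zc + g -> z i2 = zc + h ->
  z i3 = zc - (g + h) -> g ^+ 2 + g * h + h ^+ 2 = 0 ->
  congruent zc (triangle_shape I) z.
Proof.
move=> I0 [_ zI _] uniq_i e0 e1 e2 e3 gh.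
have zeta3 := cube_rootE R; set zeta := cube_root R in zeta3.
have z2 : zeta ^+ 2 = - zeta - 1.
  by apply/eqP; rewrite -subr_eq0; apply/eqP; rewrite -zeta3; ring.
have zz : zeta * (- zeta - 1) = 1.
  by transitivity (1 - (zeta ^+ 2 + zeta + 1)); [|rewrite zeta3]; ring.
have z1 : modulus zeta = 1 by exact: modulus_cexpi.
have : (h - zeta * g) * (h - zeta ^+ 2 * g) == 0.
  apply/eqP; rewrite -gh.
  transitivity (h ^+ 2 - (zeta + zeta ^+ 2) * (g * h) + zeta * zeta ^+ 2 * g ^+ 2).
    by ring.
  by rewrite z2 zz; ring.
move=> hE; have hg : modulus h = modulus g.
  move: hE; rewrite mulf_eq0 !subr_eq0 => /orP[]/eqP ->.
    by rewrite modulusM z1 mul1r.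
  by rewrite modulusM modulusX z1 expr1n mul1r.
have kg : modulus (g + h) = modulus g.
  apply: (pexpIrn (isT : (0 < 2)%N)); rewrite ?nnegrE ?modulus_ge0//.
  rewrite -modulusX (_ : (g + h) ^+ 2 = g * h).
    by rewrite modulusM hg.
  by apply/eqP; rewrite -subr_eq0 -gh; apply/eqP; ring.
have gI : 3 * modulus g ^+ 2 = I.
  rewrite -zI (sum4_indices _ uniq_i) e0 e1 e2 e3 ![zc + _]addrC !addrK addNr.
  by rewrite -!/(modulus _) modulusN kg hg modulusR normr0; ring.
have [s0 s1 s2 s3] := triangle_shapeE I.
set r := _ * Num.sqrt I in s0 s1 s2 s3.
have r0 : 0 < r by rewrite mulr_gt0 ?invr_gt0 ?sqrtr_gt0.
have rC : r%:C != 0 :> R[i] by rewrite fmorph_eq0 gt_eqF.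
have gr : modulus g = r.
  apply: (pexpIrn (isT : (0 < 2)%N)); rewrite ?nnegrE ?modulus_ge0 ?ltW//.
  by rewrite /r exprMn exprVn !sqr_sqrtr ?ltW// -gI; field.
have u1 : modulus (g / r%:C) = 1.
  by rewrite modulusM modulusV gr modulus_real ?ltW// divff// gt_eqF.
move: hE; rewrite mulf_eq0 !subr_eq0 => /orP[]/eqP hE.
- by apply: (congruent_indices uniq_i u1);
    rewrite ?s0 ?s1 ?s2 ?s3 ?e0 ?e1 ?e2 ?e3 ?hE -/zeta ?z2; field.
- have uniq_j : uniq [:: i0; i1; i3; i2].
    by move: uniq_i; rewrite /= !inE (eq_sym i3 i2); do 6!case: (_ == _).
  by apply: (congruent_indices uniq_j u1);
    rewrite ?s0 ?s1 ?s2 ?s3 ?e0 ?e1 ?e2 ?e3 ?hE -/zeta ?z2; field.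
Qed.

End Recognition.

(** * Classification of relative equilibria *)
Section Classification.
Variable R : realType.
Implicit Types (Gamma I : R) (zc a b c : R[i]) (z : quadruple R).

(** The term [i = j] is [0^-1 = 0]. *)
Definition reciprocal_sum z j := \sum_(i < 4) (z j - z i)^-1.

(** The equations of a configuration that rotates rigidly about [zc], with the
    rate already eliminated: see [stationary_relative_equilibrium]. *)
Definition relative_equilibrium zc I z :=
  forall j, reciprocal_sum z j = (6 / I)%:C * (z j - zc)^*.

Lemma quad_fiber zc a b c :
  [/\ quad zc a b c v0 = zc + (a + b + c) / 4,
      quad zc a b c v1 = zc + (a - b - c) / 4,
      quad zc a b c v2 = zc + (- a + b - c) / 4
    & quad zc a b c v3 = zc + (- a - b + c) / 4].
Proof. by []. Qed.

Lemma disc3_neq0 a b c : disc3 a b c != 0 ->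
  [/\ a - b != 0, a + b != 0 & a - c != 0] /\
  [/\ a + c != 0, b - c != 0 & b + c != 0].
Proof.
have -> : disc3 a b c = - ((b + c) * (a + c) * (a + b) * (a - b) * (a - c)
   * (b - c)) by rewrite /disc3; ring.
rewrite oppr_eq0 !mulf_eq0 !negb_or.
by move=> /andP[/andP[/andP[/andP[/andP[? ?] ?] ?]] ? ?].
Qed.

Definition triple_equation I a b c :=
  a * ((a ^+ 2 - b ^+ 2)^-1 + (a ^+ 2 - c ^+ 2)^-1) = (3 / (4 * I))%:C * a^*.

(** Partial fractions: [a (1/(a^2 - b^2) + 1/(a^2 - c^2))] is one half of the sum
    of the four numbers [1/(a +- b)], [1/(a +- c)], which is also one quarter of
    the sum of the reciprocal sums at two vertices. *)
Lemma relative_equilibrium_quad zc I a b c : I != 0 -> disc3 a b c != 0 ->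
  relative_equilibrium zc I (quad zc a b c) <->
  [/\ triple_equation I a b c, triple_equation I b c a & triple_equation I c a b].
Proof.
move=> I0 /disc3_neq0[[n1 n2 n3] [n4 n5 n6]].
have [[e01 e02 e03] [e12 e13 e23]] := quadB zc a b c.
have [q0 q1 q2 q3] := quad_fiber zc a b c.
set z := quad zc a b c in e01 e02 e03 e12 e13 e23 q0 q1 q2 q3 *.
have IC : I%:C != 0 :> R[i] by rewrite fmorph_eq0.
have lamE : (3 / (4 * I))%:C = 3 / (4 * I%:C) :> R[i].
  by rewrite rmorphM fmorphV/= rmorphM/= !rmorph_nat.
have lamE' : (6 / I)%:C = 6 / I%:C :> R[i].
  by rewrite rmorphM fmorphV/= !rmorph_nat.
have flip i j : z i - z j = - (z j - z i) by rewrite opprB.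
have S0 : reciprocal_sum z v0 = 2 / (b + c) + 2 / (a + c) + 2 / (a + b).
  rewrite /reciprocal_sum sum4E subrr e01 e02 e03 invr0.
  by field; rewrite n2 n4 n6.
have S1 : reciprocal_sum z v1 = - (2 / (b + c)) + 2 / (a - b) + 2 / (a - c).
  rewrite /reciprocal_sum sum4E subrr (flip v1 v0) e01 e12 e13 invr0.
  by field; rewrite n1 n3 n6.
have S2 : reciprocal_sum z v2 = - (2 / (a + c)) - 2 / (a - b) + 2 / (b - c).
  rewrite /reciprocal_sum sum4E subrr (flip v2 v0) (flip v2 v1) e02 e12 e23 invr0.
  by field; rewrite n1 n4 n5.
have S3 : reciprocal_sum z v3 = - (2 / (a + b)) - 2 / (a - c) - 2 / (b - c).
  rewrite /reciprocal_sum sum4E subrr (flip v3 v0) (flip v3 v1) (flip v3 v2).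
  by rewrite e03 e13 e23 invr0; field; rewrite n2 n3 n5.
have sq (x y : R[i]) : x - y != 0 -> x + y != 0 ->
    x * (x ^+ 2 - y ^+ 2)^-1 = ((x - y)^-1 + (x + y)^-1) / 2.
  move=> xy xy'; have xy2 : x ^+ 2 - y ^+ 2 != 0 by rewrite subr_sqr mulf_neq0.
  by field; rewrite xy2 xy xy'.
have n1' : b - a != 0 by rewrite -opprB oppr_eq0.
have n2' : b + a != 0 by rewrite addrC.
have n3' : c - a != 0 by rewrite -opprB oppr_eq0.
have n4' : c + a != 0 by rewrite addrC.
have n5' : c - b != 0 by rewrite -opprB oppr_eq0.
have n6' : c + b != 0 by rewrite addrC.
have TA : a * ((a ^+ 2 - b ^+ 2)^-1 + (a ^+ 2 - c ^+ 2)^-1)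
    = (reciprocal_sum z v0 + reciprocal_sum z v1) / 4.
  by rewrite mulrDr !sq// S0 S1; field; rewrite ?(n1, n1', n2, n2', n3, n3', n4, n4', n5, n5', n6, n6').
have TB : b * ((b ^+ 2 - c ^+ 2)^-1 + (b ^+ 2 - a ^+ 2)^-1)
    = (reciprocal_sum z v0 + reciprocal_sum z v2) / 4.
  by rewrite mulrDr !sq// S0 S2; field; rewrite ?(n1, n1', n2, n2', n3, n3', n4, n4', n5, n5', n6, n6').
have TC : c * ((c ^+ 2 - a ^+ 2)^-1 + (c ^+ 2 - b ^+ 2)^-1)
    = (reciprocal_sum z v0 + reciprocal_sum z v3) / 4.
  by rewrite mulrDr !sq// S0 S3; field; rewrite ?(n1, n1', n2, n2', n3, n3', n4, n4', n5, n5', n6, n6').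
rewrite /triple_equation TA TB TC lamE; split.
  move=> RE; rewrite !RE q0 q1 q2 q3 lamE'.
  by rewrite ![zc + _]addrC !addrK; split; field.
move=> [EA EB EC].
have Ssum : reciprocal_sum z v0 + reciprocal_sum z v1 + reciprocal_sum z v2
    + reciprocal_sum z v3 = 0 by rewrite S0 S1 S2 S3; ring.
have S0E : reciprocal_sum z v0 = 2 * (3 / (4 * I%:C) * (a^* + b^* + c^*)).
  by rewrite !mulrDr -EA -EB -EC -[LHS]addr0 -[X in _ + X](mul0r 2^-1) -Ssum; field.
have SE (x y w : R[i]) : (x + y) / 4 = w -> y = 4 * w - x.
  by move=> <-; field.
move=> j; elim/ord4_ind: j; rewrite ?(SE _ _ _ EA) ?(SE _ _ _ EB) ?(SE _ _ _ EC) ?S0E.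
all: rewrite ?q0 ?q1 ?q2 ?q3 lamE' [zc + _]addrC addrK; by field.
Qed.

(** When one coordinate vanishes the quadruple consists of two antipodal pairs,
    in [square_of_triple] as in [collinear_of_triple]. *)
Lemma square_of_triple zc I a b c : 0 < I -> phase_space zc I (quad zc a b c) ->
  one_zero_two_opposite (a ^+ 2) (b ^+ 2) (c ^+ 2) ->
  congruent zc (square_shape I) (quad zc a b c).
Proof.
have [q0 q1 q2 q3] := quad_fiber zc a b c.
move=> I0 zI; have sq0 (x : R[i]) : x ^+ 2 = 0 -> x = 0.
  by move/eqP; rewrite sqrf_eq0 => /eqP.
case=> -[/sq0 x0 E].
- apply: (@antipodal_square _ zc I _ v0 v3 v1 v2 ((a + b) / 4) ((a - b) / 4)) => //.
  + by rewrite q0 x0 addr0.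
  + by rewrite q3 x0; field.
  + by rewrite q1 x0 subr0.
  + by rewrite q2 x0; field.
  + by transitivity ((a ^+ 2 + b ^+ 2) / 8); [|rewrite E]; field.
- apply: (@antipodal_square _ zc I _ v0 v1 v2 v3 ((b + c) / 4) ((b - c) / 4)) => //.
  + by rewrite q0 x0 add0r.
  + by rewrite q1 x0; field.
  + by rewrite q2 x0; field.
  + by rewrite q3 x0; field.
  + by transitivity ((b ^+ 2 + c ^+ 2) / 8); [|rewrite E]; field.
- apply: (@antipodal_square _ zc I _ v0 v2 v1 v3 ((a + c) / 4) ((a - c) / 4)) => //.
  + by rewrite q0 x0 addr0.
  + by rewrite q2 x0; field.
  + by rewrite q1 x0 subr0.
  + by rewrite q3 x0; field.
  + by transitivity ((a ^+ 2 + c ^+ 2) / 8); [|rewrite E]; field.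
Qed.

(** If [x^4 + y^4 = 4 x^2 y^2], the positions [g = (x + y)/4] and
    [h = (x - y)/4] relative to the center satisfy [g^4 + h^4 = 10 g^2 h^2]. *)
Lemma collinear_of_triple zc I a b c : 0 < I -> phase_space zc I (quad zc a b c) ->
  one_zero_two_aligned (a ^+ 2) (b ^+ 2) (c ^+ 2) ->
  congruent zc (collinear_shape I) (quad zc a b c).
Proof.
have [q0 q1 q2 q3] := quad_fiber zc a b c.
have aligned (x y : R[i]) : (x ^+ 2) ^+ 2 + (y ^+ 2) ^+ 2 = 4 * (x ^+ 2 * y ^+ 2) ->
    ((x + y) / 4) ^+ 4 + ((x - y) / 4) ^+ 4
      = 10 * (((x + y) / 4) ^+ 2 * ((x - y) / 4) ^+ 2).
  move=> E; apply/eqP; rewrite -subr_eq0; apply/eqP.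
  transitivity (- (((x ^+ 2) ^+ 2 + (y ^+ 2) ^+ 2) - 4 * (x ^+ 2 * y ^+ 2)) / 32).
    by field.
  by rewrite E subrr oppr0 mul0r.
move=> I0 zI; have sq0 (x : R[i]) : x ^+ 2 = 0 -> x = 0.
  by move/eqP; rewrite sqrf_eq0 => /eqP.
case=> -[/sq0 x0 /aligned E].
- apply: (@antipodal_collinear _ zc I _ v0 v3 v1 v2 _ _ I0 zI _ _ _ _ _ E) => //.
  + by rewrite q0 x0 addr0.
  + by rewrite q3 x0; field.
  + by rewrite q1 x0 subr0.
  + by rewrite q2 x0; field.
- apply: (@antipodal_collinear _ zc I _ v0 v1 v2 v3 _ _ I0 zI _ _ _ _ _ E) => //.
  + by rewrite q0 x0 add0r.
  + by rewrite q1 x0; field.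
  + by rewrite q2 x0; field.
  + by rewrite q3 x0; field.
- apply: (@antipodal_collinear _ zc I _ v0 v2 v3 v1 _ _ I0 zI _ _ _ _ _ E) => //.
  + by rewrite q0 x0; field.
  + by rewrite q2 x0; field.
  + by rewrite q3 x0; field.
  + by rewrite q1 x0; field.
Qed.

(** The hypotheses give [a^4 + a^2 b^2 + b^4 = 0] and [c^2 = - a^2 - b^2], so
    that [b^2 +- a b + a^2 = 0] and [c = +-(a +- b)]; in each of the four cases
    one vertex is the center. *)
Lemma triangle_of_triple zc I a b c : 0 < I -> phase_space zc I (quad zc a b c) ->
  a ^+ 2 + b ^+ 2 + c ^+ 2 = 0 ->
  a ^+ 2 * b ^+ 2 + b ^+ 2 * c ^+ 2 + c ^+ 2 * a ^+ 2 = 0 ->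
  congruent zc (triangle_shape I) (quad zc a b c).
Proof.
have [q0 q1 q2 q3] := quad_fiber zc a b c.
move=> I0 zI e1 e2.
have cE : c ^+ 2 = - (a ^+ 2 + b ^+ 2).
  by apply/eqP; rewrite -addr_eq0 addrC e1.
have : (a ^+ 2 + a * b + b ^+ 2) * (a ^+ 2 - a * b + b ^+ 2) = 0.
  by rewrite -[RHS]oppr0 -e2 cE; ring.
move/eqP; rewrite mulf_eq0 => /orP[]/eqP abE.
- have : (c - (a + b)) * (c + (a + b)) == 0.
    by rewrite -subr_sqr cE -oppr_eq0 -(mulr0 2) -abE; apply/eqP; ring.
  rewrite mulf_eq0 subr_eq0 addr_eq0 => /orP[]/eqP cab.
  + apply: (@centered_triangle _ zc I _ v3 v1 v2 v0 (- b / 2) (- a / 2)) => //.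
    * by rewrite q3 cab; field.
    * by rewrite q1 cab; field.
    * by rewrite q2 cab; field.
    * by rewrite q0 cab; field.
    * by transitivity ((a ^+ 2 + a * b + b ^+ 2) / 4); [|rewrite abE]; field.
  + apply: (@centered_triangle _ zc I _ v0 v1 v2 v3 (a / 2) (b / 2)) => //.
    * by rewrite q0 cab; field.
    * by rewrite q1 cab; field.
    * by rewrite q2 cab; field.
    * by rewrite q3 cab; field.
    * by transitivity ((a ^+ 2 + a * b + b ^+ 2) / 4); [|rewrite abE]; field.
- have : (c - (a - b)) * (c + (a - b)) == 0.
    by rewrite -subr_sqr cE -oppr_eq0 -(mulr0 2) -abE; apply/eqP; ring.
  rewrite mulf_eq0 subr_eq0 addr_eq0 => /orP[]/eqP cab.
  + apply: (@centered_triangle _ zc I _ v1 v0 v3 v2 (a / 2) (- b / 2)) => //.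
    * by rewrite q1 cab; field.
    * by rewrite q0 cab; field.
    * by rewrite q3 cab; field.
    * by rewrite q2 cab; field.
    * by transitivity ((a ^+ 2 - a * b + b ^+ 2) / 4); [|rewrite abE]; field.
  + apply: (@centered_triangle _ zc I _ v2 v0 v3 v1 (b / 2) (- a / 2)) => //.
    * by rewrite q2 cab; field.
    * by rewrite q0 cab; field.
    * by rewrite q3 cab; field.
    * by rewrite q1 cab; field.
    * by transitivity ((a ^+ 2 - a * b + b ^+ 2) / 4); [|rewrite abE]; field.
Qed.

Lemma disc3_distinct a b c : disc3 a b c != 0 ->
  [/\ a ^+ 2 != b ^+ 2, b ^+ 2 != c ^+ 2 & c ^+ 2 != a ^+ 2].
Proof.
by rewrite /disc3 !mulf_eq0 !negb_or !subr_eq0 => /andP[/andP[? ?] ?].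
Qed.

Lemma relative_equilibrium_congruent zc I z : 0 < I -> phase_space zc I z ->
  relative_equilibrium zc I z ->
  [\/ congruent zc (square_shape I) z, congruent zc (collinear_shape I) z
    | congruent zc (triangle_shape I) z].
Proof.
move=> I0 zI; have [a [b [c [zE _ abc0]]]] := phase_space_quadP zI.
rewrite zE in zI * => /(relative_equilibrium_quad _ (lt0r_neq0 I0) abc0).
have [ab bc ca] := disc3_distinct abc0.
have sq (x y w : R[i]) : triple_equation I x y w -> x ^+ 2 *
    ((x ^+ 2 - y ^+ 2)^-1 + (x ^+ 2 - w ^+ 2)^-1)
      = (3 / (4 * I) * modulus (x ^+ 2))%:C.
  by move=> E; rewrite {1}expr2 -mulrA E modulusX [in RHS]rmorphM/= sqr_modulus mulrCA.
move=> [/sq EA /sq EB /sq EC].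
have k0 : 3 / (4 * I) != 0 by rewrite mulf_neq0// invr_eq0 mulf_neq0 ?gt_eqF.
have [h|h|[h1 h2]] := triple_classification k0 ab bc ca EA EB EC.
- by constructor 1; exact: square_of_triple.
- by constructor 2; exact: collinear_of_triple.
- by constructor 3; exact: triangle_of_triple.
Qed.

End Classification.

(** * Derivatives along curves of configurations *)
Section PointwiseDerivatives.
Variables (R : realType) (f g : R -> R) (t df dg : R).
Hypotheses (fE : is_derive t 1 f df) (gE : is_derive t 1 g dg).

Lemma is_derive_addf : is_derive t 1 (fun s => f s + g s) (df + dg).
Proof. exact: is_deriveD. Qed.

Lemma is_derive_subf : is_derive t 1 (fun s => f s - g s) (df - dg).
Proof. exact: is_deriveB. Qed.

Lemma is_derive_mulf : is_derive t 1 (fun s => f s * g s) (f t * dg + df * g t).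
Proof. by rewrite [df * _]mulrC; exact: is_deriveM. Qed.

Lemma is_derive_scalef k : is_derive t 1 (fun s => k * f s) (k * df).
Proof. exact: is_deriveZ. Qed.

Lemma is_derive_compf (h : R -> R) dh : is_derive (f t) 1 h dh ->
  is_derive t 1 (fun s => h (f s)) (dh * df).
Proof. by move=> hE; exact: is_derive1_comp. Qed.

End PointwiseDerivatives.

Section Kirchhoff.
Variable R : realType.
Implicit Types (Gamma I t : R) (zc w : R[i]) (z : quadruple R).

Definition is_cderive (w : R -> R[i]) t (dw : R[i]) :=
  is_derive t 1 (fun s => complex.Re (w s)) (complex.Re dw) /\
  is_derive t 1 (fun s => complex.Im (w s)) (complex.Im dw).

Lemma is_cderiveB (v w : R -> R[i]) t dv dw :
  is_cderive v t dv -> is_cderive w t dw ->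
  is_cderive (fun s => v s - w s) t (dv - dw).
Proof.
move=> [vr vi] [wr wi]; split.
- rewrite (_ : (fun s => _) = fun s => complex.Re (v s) - complex.Re (w s)).
    by rewrite raddfB; exact: is_derive_subf.
  by apply/funext => s; rewrite raddfB.
- rewrite (_ : (fun s => _) = fun s => complex.Im (v s) - complex.Im (w s)).
    by rewrite raddfB; exact: is_derive_subf.
  by apply/funext => s; rewrite raddfB.
Qed.

Lemma ln_sqrt_half (x : R) : 0 <= x -> ln (Num.sqrt x) = 2^-1 * ln x.
Proof.
rewrite le_eqVlt => /predU1P[<-|x0]; first by rewrite sqrtr0 ln0// mulr0.
have sx0 : 0 < Num.sqrt x by rewrite sqrtr_gt0.
by rewrite -[in RHS](sqr_sqrtr (ltW x0)) lnXn// mulr2n; field.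
Qed.

Lemma is_derive_sqr_modulus (w : R -> R[i]) t dw : is_cderive w t dw ->
  is_derive t 1 (fun s => modulus (w s) ^+ 2) (2 * complex.Re (dw * (w t)^*)).
Proof.
move=> [wr wi].
have -> : (fun s => modulus (w s) ^+ 2) = fun s =>
    complex.Re (w s) * complex.Re (w s) + complex.Im (w s) * complex.Im (w s).
  by apply/funext => s; rewrite sqr_modulusE !expr2.
have := is_derive_addf (is_derive_mulf wr wr) (is_derive_mulf wi wi).
move/is_derive_eq; apply.
by case: (w t) => a b; case: dw {wr wi} => c d; simpc => /=; ring.
Qed.

Lemma is_derive_ln_modulus (w : R -> R[i]) t dw : is_cderive w t dw ->
  w t != 0 ->
  is_derive t 1 (fun s => ln (modulus (w s))) (complex.Re (dw / w t)).
Proof.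
move=> dwE wt0.
have -> : (fun s => ln (modulus (w s))) =
    fun s => 2^-1 * ln (modulus (w s) ^+ 2).
  apply/funext => s; rewrite -(ger0_norm (modulus_ge0 (w s))) -sqrtr_sqr.
  by rewrite ln_sqrt_half ?sqr_ge0// sqr_sqrtr ?sqr_ge0.
have m0 : 0 < modulus (w t) ^+ 2 by rewrite exprn_gt0// modulus_gt0.
have := is_derive_scalef
  (is_derive_compf (is_derive_sqr_modulus dwE) (is_derive1_ln m0)) 2^-1.
move/is_derive_eq; apply.
have -> : dw / w t = dw * (w t)^* * (modulus (w t) ^- 2)%:C.
  rewrite fmorphV/= sqr_modulus; field.
  by rewrite fmorph_eq0 wt0.
have Re_real (x : R[i]) (y : R) : complex.Re (x * y%:C) = complex.Re x * y.
  by case: x => c d; simpc.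
by rewrite Re_real; field; rewrite gt_eqF// modulus_gt0.
Qed.

(** The logarithmic derivative of [|zi - zj|] is the real part of
    [(vi - vj) / (zi - zj)]; collecting the terms of [vj] produces the
    reciprocal sum at [j]. *)
Lemma hamiltonian_along Gamma (c : R -> quadruple R) t (v : quadruple R) :
  configuration (c t) -> (forall j, is_cderive (fun s => c s j) t (v j)) ->
  is_derive t 1 (fun s => hamiltonian Gamma (c s))
    (- (Gamma ^+ 2 / (2 * pi))
       * complex.Re (\sum_j v j * reciprocal_sum (c t) j)).
Proof.
move=> cconf dc.
have -> : (fun s => hamiltonian Gamma (c s)) = fun s =>
    - (Gamma ^+ 2 / (2 * pi))
    * (ln (modulus (c s v0 - c s v1)) + ln (modulus (c s v0 - c s v2))
       + ln (modulus (c s v0 - c s v3)) + ln (modulus (c s v1 - c s v2))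
       + ln (modulus (c s v1 - c s v3)) + ln (modulus (c s v2 - c s v3))).
  by apply/funext => s; rewrite hamiltonianE sum_pairsE.
have nz i j : i != j -> c t i - c t j != 0 by rewrite subr_eq0; exact: cconf.
have dln i j : i != j -> is_derive t 1 (fun s => ln (modulus (c s i - c s j)))
    (complex.Re ((v i - v j) / (c t i - c t j))).
  move=> ij; apply: is_derive_ln_modulus; last exact: nz.
  exact: is_cderiveB.
have d01 := dln v0 v1 isT; have d02 := dln v0 v2 isT; have d03 := dln v0 v3 isT.
have d12 := dln v1 v2 isT; have d13 := dln v1 v3 isT; have d23 := dln v2 v3 isT.
have := is_derive_addf (is_derive_addf (is_derive_addf (is_derive_addf
  (is_derive_addf d01 d02) d03) d12) d13) d23.
move/(is_derive_scalef)/(_ (- (Gamma ^+ 2 / (2 * pi))))/is_derive_eq; apply.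
congr (_ * _); rewrite -!raddfD; congr complex.Re.
rewrite /reciprocal_sum !sum4E !subrr invr0.
have flip i j : (c t i - c t j)^-1 = - (c t j - c t i)^-1.
  by rewrite -invrN opprB.
rewrite (flip v1 v0) (flip v2 v0) (flip v2 v1) (flip v3 v0) (flip v3 v1).
rewrite (flip v3 v2); ring.
Qed.

End Kirchhoff.

(** * Velocities of vortices and relative equilibria *)
Section Velocity.
Variable R : realType.
Implicit Types (Gamma I t : R) (zc w dw : R[i]) (z : quadruple R).

Let hamiltonian_move_one Gamma z j (w : R -> R[i]) t dw :
  configuration z -> is_cderive w t dw -> w t = z j ->
  is_derive t 1 (fun s => hamiltonian Gamma [eta z with j |-> w s])
    (- (Gamma ^+ 2 / (2 * pi)) * complex.Re (dw * reciprocal_sum z j)).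
Proof.
move=> zconf dwE wt.
have cE : [eta z with j |-> w t] = z :> quadruple R.
  by apply/funext => k /=; rewrite wt; case: eqP => [->|].
have := @hamiltonian_along R Gamma (fun s => [eta z with j |-> w s]) t
  (fun k => if k == j then dw else 0).
rewrite cE => /(_ zconf) along.
suff -> : dw * reciprocal_sum z j =
    \sum_k (if k == j then dw else 0) * reciprocal_sum z k.
  apply: along => k /=; case: ifP => // _.
  by split; exact: is_derive_cst.
rewrite (bigD1 j)//= eqxx big1 ?addr0// => k /negPf ->.
by rewrite mul0r.
Qed.

(** The two partial derivatives are the special cases of [hamiltonian_along]
    where a single vortex moves with velocity [1] or [i]. *)
Lemma velocityE Gamma z j : Gamma != 0 -> configuration z ->
  velocity Gamma z j = (Gamma / (2 * pi))%:C * 'i%C * (reciprocal_sum z j)^*.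
Proof.
move=> G0 zconf.
have pi0 : pi != 0 :> R by rewrite gt_eqF// pi_gt0.
have x' : is_cderive (fun s => s +i* complex.Im (z j)) (complex.Re (z j)) 1.
  by split; [exact: is_derive_id | exact: is_derive_cst].
have y' : is_cderive (fun s => complex.Re (z j) +i* s) (complex.Im (z j)) 'i%C.
  by split; [exact: is_derive_cst | exact: is_derive_id].
have zE : complex.Re (z j) +i* complex.Im (z j) = z j by case: (z j).
have dx := hamiltonian_move_one Gamma zconf x' zE.
have dy := hamiltonian_move_one Gamma zconf y' zE.
rewrite /velocity /dWdx /dWdy !derive1E (@derive_val _ _ _ _ _ _ _ dx).
rewrite (@derive_val _ _ _ _ _ _ _ dy).
case: (reciprocal_sum z j) => a b; simpc => /=; move: (@pi R) pi0 => p p0.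
by congr (_ +i* _); field; rewrite G0 p0.
Qed.

Lemma kirchhoff_is_cderive Gamma (z : R -> quadruple R) t j : Gamma != 0 ->
  kirchhoff_solution Gamma z ->
  is_cderive (fun s => z s j) t (velocity Gamma (z t) j).
Proof.
move=> G0 /(_ t j)[dx dy xE yE]; rewrite /velocity -xE -yE.
by split=> /=; rewrite mulrAC divff// mul1r derive1E; exact: derivableP.
Qed.

Lemma phase_space_of_conserved zc I z : configuration z ->
  vortex_center z = zc -> vortex_impulse z = I -> phase_space zc I z.
Proof. by move=> zconf <- <-. Qed.

Lemma sum_reciprocal_sum z : \sum_j reciprocal_sum z j = 0.
Proof.
have flip i j : (z i - z j)^-1 = - (z j - z i)^-1 by rewrite -invrN opprB.
rewrite /reciprocal_sum !sum4E !subrr invr0.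
rewrite (flip v1 v0) (flip v2 v0) (flip v2 v1) (flip v3 v0) (flip v3 v1).
rewrite (flip v3 v2); ring.
Qed.

(** Each of the six pairs contributes [(zi - zj) / (zi - zj) = 1]. *)
Lemma sum_mul_reciprocal_sum zc z : configuration z ->
  \sum_j (z j - zc) * reciprocal_sum z j = 6.
Proof.
move=> zconf; have nz i j : i != j -> z i - z j != 0.
  by rewrite subr_eq0; exact: zconf.
have flip i j : (z i - z j)^-1 = - (z j - z i)^-1 by rewrite -invrN opprB.
rewrite /reciprocal_sum !sum4E !subrr invr0.
rewrite (flip v1 v0) (flip v2 v0) (flip v2 v1) (flip v3 v0) (flip v3 v1).
rewrite (flip v3 v2); field.
by rewrite !nz.
Qed.

(** As the velocities add up to zero, stationarity makes each of them
    proportional to [zj - zc]; then [sum_mul_reciprocal_sum] determines the factor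
    of proportionality. *)
Lemma stationary_relative_equilibrium Gamma zc I z : Gamma != 0 -> I != 0 ->
  phase_space zc I z -> stationary Gamma z -> relative_equilibrium zc I z.
Proof.
move=> G0 I0 [zcE IE zconf] [_ [w wE]] j.
have pi0 : pi != 0 :> R by rewrite gt_eqF// pi_gt0.
pose g : R[i] := (Gamma / (2 * pi))%:C * 'i%C.
have g0 : g != 0.
  rewrite mulf_neq0// ?fmorph_eq0 ?mulf_neq0// ?invr_eq0 ?mulf_neq0//.
  by rewrite -modulus_eq0 modulus_i oner_eq0.
have VB i k : velocity Gamma z i - velocity Gamma z k = w * (z i - z k).
  case: (ltngtP i k) => [/wE//|/wE E|/val_inj ->]; last by rewrite !subrr mulr0.
  by rewrite -[LHS]opprB E -mulrN opprB.
have VE i : velocity Gamma z i = g * (reciprocal_sum z i)^* by exact: velocityE.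
have V0 : \sum_k velocity Gamma z k = 0.
  rewrite (eq_bigr _ (fun k _ => VE k)) -mulr_sumr -rmorph_sum.
  by rewrite sum_reciprocal_sum rmorph0 mulr0.
have V_center i : velocity Gamma z i = w * (z i - zc).
  have : \sum_k (velocity Gamma z i - velocity Gamma z k)
      = \sum_k w * (z i - z k) by apply: eq_bigr => k _; exact: VB.
  rewrite sumrB V0 subr0 -mulr_sumr sumrB !sumr_const card_ord -zcE => E.
  by apply: (mulfI (_ : 4 != 0 :> R[i])); rewrite ?pnatr_eq0// mulr_natl E; field.
pose l := (w / g)^*.
have SE i : reciprocal_sum z i = l * (z i - zc)^*.
  rewrite -rmorphM/=; apply: (can_inj (@conjcK R)); rewrite conjcK.
  by apply: (mulfI g0); rewrite -VE V_center mulrA mulrCA divff// mulr1.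
have lI : l * I%:C = 6.
  rewrite -(sum_mul_reciprocal_sum zc zconf) -IE rmorph_sum/= mulr_sumr.
  apply: eq_bigr => k _; rewrite SE -/(modulus _) sqr_modulus; ring.
rewrite SE; congr (_ * _); rewrite rmorphM fmorphV/= rmorph_nat -lI mulfK//.
by rewrite fmorph_eq0.
Qed.

Lemma omegaE Gamma I : I != 0 -> omega Gamma I = Gamma / (2 * pi) * (6 / I).
Proof.
have pi0 : pi != 0 :> R by rewrite gt_eqF// pi_gt0.
by move=> I0; rewrite /omega; move: (@pi R) pi0 => p p0; field; rewrite I0 p0.
Qed.

Lemma conjc_scale (x : R) w : (x%:C * w)^* = x%:C * w^*.
Proof. by case: w => a b; simpc. Qed.

Lemma relative_equilibrium_velocity Gamma zc I z j : Gamma != 0 -> I != 0 ->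
  configuration z -> relative_equilibrium zc I z ->
  velocity Gamma z j = 'i%C * (omega Gamma I)%:C * (z j - zc).
Proof.
move=> G0 I0 zconf RE; rewrite velocityE// RE conjc_scale conjcK omegaE//.
by rewrite [in RHS](rmorphM (real_complex R))/=; ring.
Qed.

Lemma relative_equilibrium_rigid zc I z u : modulus u = 1 ->
  relative_equilibrium zc I z ->
  relative_equilibrium zc I (fun j => zc + u * (z j - zc)).
Proof.
move=> u1 RE j.
have uu : u * u^* = 1 by rewrite -sqr_modulus u1 expr1n.
have uV : u^-1 = u^*.
  have u0 : u != 0 by rewrite -modulus_eq0 u1 oner_eq0.
  by apply: (mulfI u0); rewrite divff.
rewrite [zc + _]addrC addrK (rmorphM (@conjc R))/= mulrCA -RE /reciprocal_sum mulr_sumr.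
apply: eq_bigr => i _; rewrite -uV -invfM; congr (_^-1); ring.
Qed.

Lemma is_cderive_rigid zc (w : R) v t :
  is_cderive (fun s => zc + cexpi (w * s) * v) t ('i%C * w%:C * (cexpi (w * t) * v)).
Proof.
have dl : is_derive t 1 (fun s => w * s) w.
  by have := is_derive_scalef (is_derive_id t 1) w; rewrite mulr1.
have dcos := is_derive_compf dl (is_derive_cos (w * t)).
have dsin := is_derive_compf dl (is_derive_sin (w * t)).
case: zc v => [zx zy] [x y]; split.
- have -> : (fun s => complex.Re ((zx +i* zy) + cexpi (w * s) * (x +i* y))) =
      (fun s => zx + (x * cos (w * s) - y * sin (w * s))).
    by apply/funext => s; rewrite /cexpi; simpc => /=; ring.
  have := is_derive_addf (is_derive_cst zx t 1)
    (is_derive_subf (is_derive_scalef dcos x) (is_derive_scalef dsin y)).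
  by move/is_derive_eq; apply; rewrite /cexpi; simpc => /=; ring.
- have -> : (fun s => complex.Im ((zx +i* zy) + cexpi (w * s) * (x +i* y))) =
      (fun s => zy + (y * cos (w * s) + x * sin (w * s))).
    by apply/funext => s; rewrite /cexpi; simpc => /=; ring.
  have := is_derive_addf (is_derive_cst zy t 1)
    (is_derive_addf (is_derive_scalef dcos y) (is_derive_scalef dsin x)).
  by move/is_derive_eq; apply; rewrite /cexpi; simpc => /=; ring.
Qed.

End Velocity.

(** * Uniqueness of solutions *)
Section Uniqueness.
Variable R : realType.
Implicit Types (Gamma I t : R) (zc w : R[i]) (z y : quadruple R).

(** If [m] is at most [L] on the interval, then [D t exp (- L t)] decreases from
    zero. *)
Let gronwall_right (D D' m m' : R -> R) (T : R) :
  (forall t, is_derive t 1 D (D' t)) -> (forall t, is_derive t 1 m (m' t)) ->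
  (forall t, D' t <= m t * D t) -> (forall t, 0 <= D t) -> D 0 = 0 ->
  0 <= T -> D T = 0.
Proof.
move=> dD dm le_D' D_ge0 D0 T0.
have m_cont : {within `[0, T], continuous m}%classic.
  by apply: derivable_within_continuous => t _; have [] := dm t.
have [c _ le_mc] := EVT_max T0 m_cont.
pose h t := D t * expR (- m c * t).
have dh t : is_derive t 1 h ((D' t - m c * D t) * expR (- m c * t)).
  have dl : is_derive t 1 (fun s => - m c * s) (- m c).
    by have := is_derive_scalef (is_derive_id t 1) (- m c); rewrite mulr1.
  have := is_derive_mulf (dD t) (is_derive_compf dl (is_derive_expR _)).
  by move/is_derive_eq; apply; ring.
have : h T <= h 0.
  apply: (@ler0_derive1_nincr _ h 0 T) => //.
  - move=> t; rewrite in_itv/= => /andP[t0 tT].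
    rewrite derive1E (@derive_val _ _ _ _ _ _ _ (dh t)).
    rewrite mulr_le0_ge0 ?expR_ge0// subr_le0 (le_trans (le_D' t))//.
    by rewrite ler_wpM2r// le_mc// in_itv/= (ltW t0) (ltW tT).
  - by apply: derivable_within_continuous => t _; have [] := dh t.
rewrite /h D0 mul0r pmulr_lle0 ?expR_gt0// => DT.
by apply/eqP; rewrite eq_le DT D_ge0.
Qed.

Lemma gronwall_zero (D D' m m' : R -> R) :
  (forall t, is_derive t 1 D (D' t)) -> (forall t, is_derive t 1 m (m' t)) ->
  (forall t, `|D' t| <= m t * D t) -> (forall t, 0 <= D t) -> D 0 = 0 ->
  forall t, D t = 0.
Proof.
move=> dD dm le_D' D_ge0 D0 t; have [t0|/ltW t0] := leP 0 t.
  apply: (gronwall_right dD dm) => // s.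
  exact: le_trans (ler_norm _) (le_D' s).
have opp (f f' : R -> R) (s : R) : (forall s : R, is_derive s 1 f (f' s)) ->
    is_derive s 1 (fun s => f (- s)) (- f' (- s)).
  move=> df; have dN : is_derive s 1 (fun s : R => - s) (-1).
    exact: is_deriveN.
  by have := is_derive_compf dN (df (- s)); rewrite mulrN1.
rewrite -[t]opprK; apply: (@gronwall_right (fun s => D (- s))
    (fun s => - D' (- s)) (fun s => m (- s)) (fun s => - m' (- s))) => //=.
- by move=> s; rewrite (le_trans _ (le_D' (- s)))// -normrN ler_norm.
- by rewrite oppr0.
- by rewrite oppr_ge0.
Qed.

Definition vortex_field Gamma z : quadruple R := fun j =>
  (Gamma / (2 * pi))%:C * 'i%C * (reciprocal_sum z j)^*.

Definition inverse_squares z :=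
  \sum_(i < 4) \sum_(j < 4 | (i < j)%N) (modulus (z i - z j) ^+ 2)^-1.

(** The difference of two reciprocals is divisible by the difference of the
    numbers, and [1/(|w| |v|)] is bounded by the mean of the inverse squares. *)
Let pair_bound (p q w v d : R[i]) (D : R) :
  w != 0 -> v != 0 -> w - v = p - q -> modulus p ^+ 2 + modulus q ^+ 2 <= D ->
  modulus ((p - q) * (w^-1 - v^-1))
    <= D * ((modulus w ^+ 2)^-1 + (modulus v ^+ 2)^-1).
Proof.
move=> w0 v0 wv leD.
have -> : (p - q) * (w^-1 - v^-1) = - ((p - q) ^+ 2 * (w^-1 * v^-1)).
  by rewrite -wv; field; rewrite w0 v0.
rewrite modulusN modulusM modulusX modulusM !modulusV -!exprVn.
set a := (modulus w)^-1; set b := (modulus v)^-1.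
have le1 : modulus (p - q) ^+ 2 <= 2 * D.
  have := modulus_parallelogram p q; have := sqr_ge0 (modulus (p + q)); lra.
have a0 : 0 <= a by rewrite invr_ge0 modulus_ge0.
have b0 : 0 <= b by rewrite invr_ge0 modulus_ge0.
have D0 : 0 <= D by apply: le_trans leD; rewrite addr_ge0 ?sqr_ge0.
apply: (@le_trans _ _ (2 * D * (a * b))).
  by rewrite ler_wpM2r// mulr_ge0.
have : 0 <= D * (a - b) ^+ 2 by rewrite mulr_ge0 ?sqr_ge0.
by lra.
Qed.

(** Summation by parts turns the pairing of the field difference with [z - y]
    into a sum over pairs of vortices, to which [pair_bound] applies.  The
    Lipschitz constant is bounded along any collision-free motion on a compact
    time interval. *)
Lemma vortex_field_lipschitz Gamma z y : configuration z -> configuration y ->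
  `|complex.Re (\sum_j (vortex_field Gamma z j - vortex_field Gamma y j)
                        * (z j - y j)^*)|
  <= `|Gamma / (2 * pi)| * (inverse_squares z + inverse_squares y)
     * \sum_j modulus (z j - y j) ^+ 2.
Proof.
move=> zconf yconf; pose d j := z j - y j; pose D := \sum_j modulus (d j) ^+ 2.
pose f i j := (d i - d j) * ((z i - z j)^-1 - (y i - y j)^-1).
have -> : \sum_j (vortex_field Gamma z j - vortex_field Gamma y j) * (z j - y j)^*
    = (Gamma / (2 * pi))%:C * 'i%C *
      (f v0 v1 + f v0 v2 + f v0 v3 + f v1 v2 + f v1 v3 + f v2 v3)^*.
  transitivity ((Gamma / (2 * pi))%:C * 'i%C *
    (\sum_j (reciprocal_sum z j - reciprocal_sum y j) * d j)^*).
    rewrite rmorph_sum/= mulr_sumr; apply: eq_bigr => j _.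
    by rewrite (rmorphM (@conjc R))/= (rmorphB (@conjc R))/= /vortex_field; ring.
  congr (_ * _^*); rewrite /reciprocal_sum !sum4E !subrr invr0.
  have flip (x : quadruple R) i j : (x i - x j)^-1 = - (x j - x i)^-1.
    by rewrite -invrN opprB.
  rewrite (flip z v1 v0) (flip z v2 v0) (flip z v2 v1) (flip z v3 v0).
  rewrite (flip z v3 v1) (flip z v3 v2) (flip y v1 v0) (flip y v2 v0).
  rewrite (flip y v2 v1) (flip y v3 v0) (flip y v3 v1) (flip y v3 v2) /f.
  by ring.
apply: (le_trans (ler_Re_modulus _)).
rewrite !modulusM modulus_i mulr1 modulusR modulus_conj -mulrA.
apply: ler_wpM2l => //; rewrite mulrC -/D.
have fB i j : i != j -> modulus (d i) ^+ 2 + modulus (d j) ^+ 2 <= D ->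
    modulus (f i j) <= D * ((modulus (z i - z j) ^+ 2)^-1
                            + (modulus (y i - y j) ^+ 2)^-1).
  move=> ij leD; apply: pair_bound => //; rewrite ?subr_eq0 ?zconf ?yconf//.
  by rewrite /d; ring.
have DE : D = modulus (d v0) ^+ 2 + modulus (d v1) ^+ 2 + modulus (d v2) ^+ 2
    + modulus (d v3) ^+ 2 by rewrite /D sum4E.
have p0 := sqr_ge0 (modulus (d v0)); have p1 := sqr_ge0 (modulus (d v1)).
have p2 := sqr_ge0 (modulus (d v2)); have p3 := sqr_ge0 (modulus (d v3)).
have f01 := fB v0 v1 isT ltac:(lra); have f02 := fB v0 v2 isT ltac:(lra).
have f03 := fB v0 v3 isT ltac:(lra); have f12 := fB v1 v2 isT ltac:(lra).
have f13 := fB v1 v3 isT ltac:(lra); have f23 := fB v2 v3 isT ltac:(lra).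
have sub6 (x1 x2 x3 x4 x5 x6 : R[i]) : modulus (x1 + x2 + x3 + x4 + x5 + x6)
    <= modulus x1 + modulus x2 + modulus x3 + modulus x4 + modulus x5 + modulus x6.
  by do 4!(apply: (le_trans (ler_modulusD _ _)); rewrite lerD2r);
    exact: ler_modulusD.
apply: (le_trans (sub6 _ _ _ _ _ _)); rewrite /inverse_squares !sum_pairsE.
by lra.
Qed.

Definition follows_field Gamma (z : R -> quadruple R) :=
  forall t j, is_cderive (fun s => z s j) t (vortex_field Gamma (z t) j).

Let is_derive_inverse_squares Gamma (z : R -> quadruple R) :
  follows_field Gamma z -> (forall t, configuration (z t)) ->
  exists dm : R -> R,
    forall t, is_derive t 1 (fun s => inverse_squares (z s)) (dm t).
Proof.
move=> zE zconf.
pose f i j s := (modulus (z s i - z s j) ^+ 2)^-1.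
have dm2 i j t : i != j -> {df | is_derive t 1 (f i j) df}.
  move=> ij; have := is_derive_sqr_modulus (is_cderiveB (zE t i) (zE t j)).
  set df := (X in is_derive _ _ _ X) => dE.
  have m0 : modulus (z t i - z t j) ^+ 2 != 0.
    by rewrite sqrf_eq0 modulus_eq0 subr_eq0; exact: zconf.
  by have := is_deriveV m0; eexists; exact: is_deriveV.
have E : (fun s => inverse_squares (z s)) = fun s => f v0 v1 s + f v0 v2 s
    + f v0 v3 s + f v1 v2 s + f v1 v3 s + f v2 v3 s.
  by apply/funext => s; rewrite /inverse_squares sum_pairsE.
pose df i j t (ij : i != j) := sval (dm2 i j t ij).
exists (fun t => df v0 v1 t isT + df v0 v2 t isT + df v0 v3 t isT
  + df v1 v2 t isT + df v1 v3 t isT + df v2 v3 t isT) => t.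
have dfE i j ij : is_derive t 1 (f i j) (df i j t ij) := svalP (dm2 i j t ij).
rewrite E; exact: (is_derive_addf (is_derive_addf (is_derive_addf
  (is_derive_addf (is_derive_addf (dfE _ _ _) (dfE _ _ _)) (dfE _ _ _))
  (dfE _ _ _)) (dfE _ _ _)) (dfE _ _ _)).
Qed.

Lemma follows_field_unique Gamma (z y : R -> quadruple R) :
  follows_field Gamma z -> follows_field Gamma y ->
  (forall t, configuration (z t)) -> (forall t, configuration (y t)) ->
  z 0 = y 0 -> z = y.
Proof.
move=> zE yE zconf yconf zy0.
pose d j s := modulus (z s j - y s j) ^+ 2.
pose d' j t := 2 * complex.Re ((vortex_field Gamma (z t) j
  - vortex_field Gamma (y t) j) * (z t j - y t j)^*).
have dd j t : is_derive t 1 (d j) (d' j t).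
  exact: is_derive_sqr_modulus (is_cderiveB (zE t j) (yE t j)).
pose D s := d v0 s + d v1 s + d v2 s + d v3 s.
have DE s : D s = \sum_j modulus (z s j - y s j) ^+ 2 by rewrite sum4E.
have dD t : is_derive t 1 D (d' v0 t + d' v1 t + d' v2 t + d' v3 t).
  exact: (is_derive_addf (is_derive_addf (is_derive_addf (dd _ _) (dd _ _))
    (dd _ _)) (dd _ _)).
have [mz mzE] := is_derive_inverse_squares zE zconf.
have [my myE] := is_derive_inverse_squares yE yconf.
pose m s := 2 * `|Gamma / (2 * pi)|
  * (inverse_squares (z s) + inverse_squares (y s)).
have dm t : is_derive t 1 m (2 * `|Gamma / (2 * pi)| * (mz t + my t)).
  by apply: is_derive_scalef; exact: is_derive_addf.
have D0 : D 0 = 0.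
  by rewrite DE zy0 big1// => j _; rewrite subrr modulusR normr0 expr0n.
have D_ge0 t : 0 <= D t by rewrite DE sumr_ge0// => j _; exact: sqr_ge0.
have leD' t : `|d' v0 t + d' v1 t + d' v2 t + d' v3 t| <= m t * D t.
  have -> : d' v0 t + d' v1 t + d' v2 t + d' v3 t = 2 * complex.Re (\sum_j
      (vortex_field Gamma (z t) j - vortex_field Gamma (y t) j)
        * (z t j - y t j)^*) by rewrite raddf_sum/= mulr_sumr sum4E.
  rewrite normrM ger0_norm// /m -!mulrA ler_wpM2l// mulrA DE.
  exact: vortex_field_lipschitz.
have Dz := gronwall_zero dD dm leD' D_ge0 D0.
apply/funext => t; apply/funext => j; apply/eqP; rewrite -subr_eq0 -modulus_eq0.
rewrite -sqrf_eq0; have := Dz t; rewrite DE => /eqP.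
by rewrite psumr_eq0 => [/allP/(_ j)|i _]; [exact | exact: sqr_ge0].
Qed.

End Uniqueness.

(** * Global minimizers *)
Section Minimizers.
Variable R : realType.
Implicit Types (Gamma I : R) (zc a b c u : R[i]) (z s : quadruple R).

Lemma hamiltonian_quad_le Gamma zc a b c a' b' c' : Gamma != 0 ->
  disc3 a b c != 0 -> disc3 a' b' c' != 0 ->
  (hamiltonian Gamma (quad zc a b c) <= hamiltonian Gamma (quad zc a' b' c'))
    = (modulus (disc3 a' b' c') <= modulus (disc3 a b c)).
Proof.
move=> G0 d0 d0'; have /quad_config conf := d0; have /quad_config conf' := d0'.
rewrite !hamiltonian_quad//.
have k0 : 0 < Gamma ^+ 2 / (2 * pi).
  by apply: divr_gt0; [rewrite exprn_even_gt0 | rewrite mulr_gt0 ?pi_gt0].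
by rewrite !mulNr lerN2 ler_pM2l// lerD2r ler_ln// posrE modulus_gt0.
Qed.

Lemma disc3_le I a b c :
  modulus a ^+ 2 + modulus b ^+ 2 + modulus c ^+ 2 = 4 * I ->
  modulus (disc3 a b c) <= 16 * I ^+ 3 /\
  (0 < I -> modulus (disc3 a b c) = 16 * I ^+ 3 ->
   one_zero_two_opposite (a ^+ 2) (b ^+ 2) (c ^+ 2)).
Proof.
have [] := disc3_bound (a ^+ 2) (b ^+ 2) (c ^+ 2).
rewrite !modulusX -/(disc3 a b c) => h1 h2 E; rewrite E in h1 h2.
have E3 : (4 * I) ^+ 3 = 64 * I ^+ 3 by ring.
rewrite E3 in h1 h2; split; first by lra.
by move=> I0 eq16; apply: h2; [rewrite mulr_gt0 | rewrite eq16; ring].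
Qed.

Lemma quad_of_shape zc u s : s v0 + s v1 + s v2 + s v3 = 0 ->
  (fun j => zc + u * s j) =
  quad zc (u * (s v0 + s v1 - s v2 - s v3)) (u * (s v0 - s v1 + s v2 - s v3))
    (u * (s v0 - s v1 - s v2 + s v3)).
Proof.
move=> s0; have s3 : s v3 = - (s v0 + s v1 + s v2).
  by apply/eqP; rewrite -addr_eq0 addrC s0.
by apply: quadruple_eq; rewrite /quad/= s3; field.
Qed.

Lemma congruent_quad zc s z : congruent zc s z ->
  s v0 + s v1 + s v2 + s v3 = 0 ->
  exists (sigma : 'S_4) u, modulus u = 1 /\ z \o sigma =
    quad zc (u * (s v0 + s v1 - s v2 - s v3)) (u * (s v0 - s v1 + s v2 - s v3))
      (u * (s v0 - s v1 - s v2 + s v3)).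
Proof.
move=> [sigma [u [u1 E]]] s0; exists sigma, u; split=> //.
by rewrite -quad_of_shape//; apply/funext => j /=; exact: E.
Qed.

(** The factor is [u^6], as [disc3] is homogeneous of degree six. *)
Lemma disc3_unit u a b c : modulus u = 1 ->
  modulus (disc3 (u * a) (u * b) (u * c)) = modulus (disc3 a b c).
Proof.
move=> u1; have -> : disc3 (u * a) (u * b) (u * c) = u ^+ 6 * disc3 a b c.
  by rewrite /disc3; ring.
by rewrite modulusM modulusX u1 expr1n mul1r.
Qed.

Lemma sqr_modulus_unit u a : modulus u = 1 -> modulus (u * a) ^+ 2 = modulus a ^+ 2.
Proof. by move=> u1; rewrite modulusM u1 mul1r. Qed.

(** The square of circumradius one has coordinates [2 + 2i, 0, 2 - 2i]. *)
Lemma congruent_square_quad zc I z : 0 < I -> congruent zc (square_shape I) z ->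
  exists (sigma : 'S_4) a b c, [/\ z \o sigma = quad zc a b c,
    modulus a ^+ 2 + modulus b ^+ 2 + modulus c ^+ 2 = 4 * I
    & modulus (disc3 a b c) = 16 * I ^+ 3].
Proof.
move=> I0 /congruent_quad; have [-> -> -> ->] := square_shapeE I.
set r := 2^-1 * Num.sqrt I; case; first by ring.
move=> sigma [u [u1 zE]]; exists sigma.
have r2 : r ^+ 2 = I / 4 by rewrite exprMn sqr_sqrtr ?ltW//; field.
move: zE; set a := (_ + _ - _ - _); set b := (_ - _ + _ - _).
set c := (_ - _ - _ + _) => zE; exists (u * a), (u * b), (u * c); split=> //.
  rewrite !sqr_modulus_unit// (_ : b = 0) ?modulusR ?normr0; last by rewrite /b; ring.
  rewrite !sqr_modulusE /a /c; simpc => /=.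
  by transitivity (16 * r ^+ 2); [ring | rewrite r2; field].
have ii := mulii R.
rewrite disc3_unit// (_ : disc3 _ _ _ = (1024 * r ^+ 6)%:C * 'i%C); last first.
  by rewrite /disc3 /a /b /c; ring: ii.
rewrite modulusM modulus_i mulr1 modulusR (_ : _ * _ = 16 * I ^+ 3).
  by rewrite ger0_norm// mulr_ge0// exprn_ge0// ltW.
by transitivity (1024 * (r ^+ 2) ^+ 3); [ring | rewrite r2; field].
Qed.

Lemma global_minimizerP Gamma zc I z : Gamma != 0 -> 0 < I ->
  global_minimizer Gamma zc I z <-> congruent zc (square_shape I) z.
Proof.
move=> G0 I0; split; last first.
  move=> /(congruent_square_quad I0)[sigma [a [b [c [zE abcI disc16]]]]].
  have abc0 : disc3 a b c != 0.
    by rewrite -modulus_eq0 disc16 mulf_neq0// expf_neq0// gt_eqF.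
  split; first by rewrite -(phase_space_perm _ _ _ sigma) zE; apply/phase_space_quad.
  move=> z' /phase_space_quadP[a' [b' [c' [-> abcI' abc0']]]].
  rewrite -(hamiltonian_perm _ _ sigma) zE hamiltonian_quad_le// disc16.
  by have [] := disc3_le abcI'.
move=> [zI zmin]; have [a [b [c [zE abcI abc0]]]] := phase_space_quadP zI.
have self : congruent zc (square_shape I) (fun j => zc + square_shape I j).
  exists 1%g, 1; split=> [|j]; last by rewrite perm1 mul1r.
  by rewrite (modulus_real ler01).
have [sigma [a' [b' [c' [_ abcI' disc16]]]]] := congruent_square_quad I0 self.
have abc0' : disc3 a' b' c' != 0.
  by rewrite -modulus_eq0 disc16 mulf_neq0// expf_neq0// gt_eqF.
have := zmin (quad zc a' b' c') ((phase_space_quad _ _ _ _ _).2 (conj abcI' abc0')).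
rewrite zE hamiltonian_quad_le// disc16 => ge16.
rewrite zE in zI; apply: square_of_triple => //; have [le16 eq16] := disc3_le abcI.
by apply: eq16 => //; apply/eqP; rewrite eq_le le16.
Qed.

End Minimizers.

(** * Critical points and deformations *)
Section Saddles.
Variable R : realType.
Implicit Types (Gamma I : R) (zc a b c u : R[i]) (z s : quadruple R).

(** Along a curve, the derivative of the Hamiltonian is a constant multiple of
    that of the impulse, which is constant in the phase space. *)
Lemma relative_equilibrium_critical Gamma zc I z : 0 < I ->
  phase_space zc I z -> relative_equilibrium zc I z ->
  critical_point Gamma zc I z.
Proof.
move=> I0 zI RE; split=> // c c0 cI dc; have [_ _ zconf] := zI.
pose v j : R[i] := 'D_1 (fun t => complex.Re (c t j)) 0
  +i* 'D_1 (fun t => complex.Im (c t j)) 0.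
have dcv j : is_cderive (fun t => c t j) 0 (v j).
  by have [dx dy] := dc j; split; exact: derivableP.
have := @hamiltonian_along R Gamma c 0 v; rewrite c0 => /(_ zconf dcv).
move/is_derive_eq; apply.
have dcz j : is_cderive (fun t => c t j - zc) 0 (v j).
  have := is_cderiveB (dcv j) (_ : is_cderive (fun=> zc) 0 0).
  rewrite subr0; apply; split; exact: is_derive_cst.
have dm j := is_derive_sqr_modulus (dcz j).
have dimpulse := is_derive_addf (is_derive_addf (is_derive_addf
  (dm v0) (dm v1)) (dm v2)) (dm v3).
set f := (X in is_derive _ _ X _) in dimpulse.
have fI : \forall t \near (0 : R), I = f t.
  by apply: filterS cI => t [_ <- _]; rewrite sum4E.
have dI := near_eq_is_derive fI (is_derive_cst I (0 : R) 1).
have sum0 : \sum_j 2 * complex.Re (v j * (z j - zc)^*) = 0.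
  rewrite sum4E -c0 -[LHS](@derive_val _ _ _ _ _ _ _ dimpulse).
  exact: (@derive_val _ _ _ _ _ _ _ dI).
rewrite (_ : complex.Re _ = 0) ?mulr0// raddf_sum/=.
transitivity (3 / I * \sum_j 2 * complex.Re (v j * (z j - zc)^*)); last first.
  by rewrite sum0 mulr0.
rewrite mulr_sumr; apply: eq_bigr => j _; rewrite RE mulrCA.
rewrite (_ : complex.Re ((6 / I)%:C * _) = 6 / I * complex.Re (v j * (z j - zc)^*)).
  by field; rewrite gt_eqF.
by case: (v j * _) => x y; simpc.
Qed.

(** The positions are averages of the coordinates with weights [+-1/4], and the
    Hamiltonian decreases with [|disc3|]: deformations of the coordinates of size
    [O(delta)] suffice to exclude a local extremum. *)
Lemma not_local_extremum Gamma zc I a b c (larger : bool) (K : R) :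
  Gamma != 0 -> phase_space zc I (quad zc a b c) ->
  (forall delta : R, 0 < delta -> delta <= 4^-1 -> exists a' b' c',
    [/\ modulus (a' - a) <= K * delta, modulus (b' - b) <= K * delta,
        modulus (c' - c) <= K * delta,
        modulus a' ^+ 2 + modulus b' ^+ 2 + modulus c' ^+ 2 = 4 * I
      & if larger then modulus (disc3 a b c) < modulus (disc3 a' b' c')
        else 0 < modulus (disc3 a' b' c') < modulus (disc3 a b c)]) ->
  if larger then ~ local_minimum Gamma zc I (quad zc a b c)
  else ~ local_maximum Gamma zc I (quad zc a b c).
Proof.
move=> G0 /phase_space_quad[abcI abc0] perturb.
have near_quad e : 0 < e -> exists a' b' c',
    [/\ near_quadruple e (quad zc a b c) (quad zc a' b' c'),
        modulus a' ^+ 2 + modulus b' ^+ 2 + modulus c' ^+ 2 = 4 * I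
      & if larger then modulus (disc3 a b c) < modulus (disc3 a' b' c')
        else 0 < modulus (disc3 a' b' c') < modulus (disc3 a b c)].
  (* three displacements of size [K delta], weighted by [1/4], stay below [e] *)
  move=> e0; pose delta := Num.min 4^-1 (e / (`|K| + 1)).
  have K0 : 0 < `|K| + 1 by rewrite ltr_wpDl.
  have d0 : 0 < delta by rewrite lt_min invr_gt0 ltr0n divr_gt0.
  have d4 : delta <= 4^-1 by rewrite ge_min lexx.
  have Kd : K * delta < 4 / 3 * e.
    apply: (@le_lt_trans _ _ (`|K| * delta)); first by rewrite ler_wpM2r ?ler_norm ?ltW.
    apply: (@le_lt_trans _ _ (`|K| * (e / (`|K| + 1)))).
      by rewrite ler_wpM2l// ge_min lexx orbT.
    apply: (@le_lt_trans _ _ e); last by lra.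
    by rewrite mulrCA -[leRHS]mulr1 ler_pM2l// ler_pdivrMr// mul1r lerDl.
  have [a' [b' [c' [aa bb cc abc' larger']]]] := perturb delta d0 d4.
  exists a', b', c'; split=> // j.
  have bound (x y w : R[i]) : modulus x = modulus (a' - a) ->
      modulus y = modulus (b' - b) -> modulus w = modulus (c' - c) ->
      modulus ((x + y + w) / 4) < e.
    move=> xE yE wE; rewrite modulusM modulusV (_ : modulus 4 = 4); last first.
      by rewrite -(rmorph_nat (real_complex R) 4) modulus_real.
    have := ler_modulusD (x + y) w; have := ler_modulusD x y; lra.
  elim/ord4_ind: j; rewrite /quad/= -/(modulus _).
  - have := bound (a' - a) (b' - b) (c' - c) erefl erefl erefl.
    by congr (modulus _ < _); field.
  - have := bound (a' - a) (b - b') (c - c') erefl (modulusBC _ _) (modulusBC _ _).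
    by congr (modulus _ < _); field.
  - have := bound (a - a') (b' - b) (c - c') (modulusBC _ _) erefl (modulusBC _ _).
    by congr (modulus _ < _); field.
  - have := bound (a - a') (b - b') (c' - c) (modulusBC _ _) (modulusBC _ _) erefl.
    by congr (modulus _ < _); field.
have phase a' b' c' : modulus a' ^+ 2 + modulus b' ^+ 2 + modulus c' ^+ 2 = 4 * I ->
    0 < modulus (disc3 a' b' c') ->
    phase_space zc I (quad zc a' b' c') /\ disc3 a' b' c' != 0.
  by rewrite modulus_gt0 => E d0; split=> //; apply/phase_space_quad.
case: larger perturb near_quad => _ near_quad [e e0 extremal].
- have [a' [b' [c' [near_e abc' lt']]]] := near_quad e e0.
  have [zI d0] := phase _ _ _ abc' (le_lt_trans (modulus_ge0 _) lt').
  by have := extremal _ zI near_e; rewrite hamiltonian_quad_le// leNgt lt'.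
- have [a' [b' [c' [near_e abc' /andP[pos lt']]]]] := near_quad e e0.
  have [zI d0] := phase _ _ _ abc' pos.
  by have := extremal _ zI near_e; rewrite hamiltonian_quad_le// leNgt lt'.
Qed.

Lemma saddle_point_perm Gamma zc I z (sigma : 'S_4) :
  saddle_point Gamma zc I (z \o sigma) -> saddle_point Gamma zc I z.
Proof.
move=> [[zI zcrit] zmin zmax]; split.
- split; first exact/(phase_space_perm _ _ _ sigma).
  move=> c c0 cI dc; have := zcrit (fun t => c t \o sigma).
  have E : (fun t => hamiltonian Gamma (c t \o sigma))
      = (fun t => hamiltonian Gamma (c t)).
    by apply/funext => t; rewrite hamiltonian_perm.
  rewrite E c0 => /(_ erefl); apply; last by move=> j; exact: dc.
  by apply: filterS cI => t /= ctI; apply/phase_space_perm.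
- move=> [e e0 emin]; apply: zmin; exists e => // z' z'I near_z'.
  rewrite hamiltonian_perm -[z'](_ : (z' \o (sigma^-1)%g) \o sigma = z'); last first.
    by apply/funext => j /=; rewrite permK.
  rewrite hamiltonian_perm; apply: emin; first exact/phase_space_perm.
  by move=> j; have := near_z' ((sigma^-1)%g j); rewrite /= permKV.
- move=> [e e0 emax]; apply: zmax; exists e => // z' z'I near_z'.
  rewrite hamiltonian_perm -[z'](_ : (z' \o (sigma^-1)%g) \o sigma = z'); last first.
    by apply/funext => j /=; rewrite permK.
  rewrite hamiltonian_perm; apply: emax; first exact/phase_space_perm.
  by move=> j; have := near_z' ((sigma^-1)%g j); rewrite /= permKV.
Qed.

End Saddles.

(** * Collinear and triangular configurations are saddles *)
Section SaddleConfigurations.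
Variable R : realType.
Implicit Types (Gamma I : R) (zc a b c u : R[i]) (z s : quadruple R).

Lemma triple_equation_unit I u a b c : modulus u = 1 ->
  a ^+ 2 != b ^+ 2 -> a ^+ 2 != c ^+ 2 ->
  triple_equation I a b c -> triple_equation I (u * a) (u * b) (u * c).
Proof.
rewrite /triple_equation -subr_eq0 => u1 ab; rewrite -subr_eq0 => ac E.
have uu : u * u^* = 1 by rewrite -sqr_modulus u1 expr1n.
have u0 : u != 0 by rewrite -modulus_eq0 u1 oner_eq0.
have uV : u^* = u^-1 by apply: (mulfI u0); rewrite divff.
rewrite (rmorphM (@conjc R))/= mulrCA -E uV !exprMn -!mulrBr.
by field; rewrite ab ac u0.
Qed.

(** [sqrt (1 - delta^2)] is the scaling factor that makes room, under the
    quadratic constraint, for a displacement of relative size [delta]. *)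
Let sqrt_one_sub (delta : R) : 0 < delta -> delta <= 4^-1 ->
  let k := Num.sqrt (1 - delta ^+ 2) in
  [/\ k ^+ 2 = 1 - delta ^+ 2, 0 <= k & `|k - 1| <= delta].
Proof.
move=> d0 d4 k; have dd : delta ^+ 2 <= delta.
  by rewrite expr2 ler_piMr ?ltW//; lra.
have kE : k ^+ 2 = 1 - delta ^+ 2 by rewrite sqr_sqrtr//; lra.
have k0 : 0 <= k by exact: sqrtr_ge0.
have k1 : k <= 1.
  by rewrite -(@ler_pXn2r _ 2) ?nnegrE// expr1n kE gerBl sqr_ge0.
have k2 : 1 - delta <= k.
  rewrite -(@ler_pXn2r _ 2) ?nnegrE ?kE//; last by lra.
  by rewrite sqrrB expr1n mul1r; lra.
by split=> //; rewrite ler0_norm ?subr_le0//; lra.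
Qed.

(** Effect of the deformations on [(A - B) (B - C) (C - A)] when [A = 0] and
    [B], [C] satisfy the equation of [one_zero_two_aligned]: [B] and [C] shrink
    by the factor [1 - e], while [A] becomes [- (B + C) e] in [aligned_up] and
    [(B + C) e] in [aligned_down]. *)
Let aligned_up (B C e : R) : B ^+ 2 + C ^+ 2 = 4 * (B * C) ->
  (- ((B + C) * e) - (1 - e) * B) * ((1 - e) * B - (1 - e) * C)
    * ((1 - e) * C + (B + C) * e)
  = - B * (B - C) * C * ((1 - e) * (1 + 4 * e + e ^+ 2)).
Proof.
move=> BC.
transitivity (- ((1 - e) * (B - C) * ((1 + e ^+ 2) * (B * C)
  + e * (B ^+ 2 + C ^+ 2)))); first by ring.
by rewrite BC; ring.
Qed.

Let aligned_down (B C e : R) : B ^+ 2 + C ^+ 2 = 4 * (B * C) ->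
  ((B + C) * e - (1 - e) * B) * ((1 - e) * B - (1 - e) * C)
    * ((1 - e) * C - (B + C) * e)
  = - B * (B - C) * C * ((1 - e) * (1 - 8 * e + 13 * e ^+ 2)).
Proof.
move=> BC.
transitivity (- ((1 - e) * (B - C) * (((1 - 2 * e) ^+ 2 + e ^+ 2) * (B * C)
  - e * (1 - 2 * e) * (B ^+ 2 + C ^+ 2)))); first by ring.
by rewrite BC; ring.
Qed.

Let aligned_reciprocals (B C : R) : B ^+ 2 + C ^+ 2 = 4 * (B * C) ->
  B != 0 -> B - C != 0 -> B + C != 0 -> (B - C)^-1 + B^-1 = 3 / (B + C).
Proof.
move=> BC B0 BC0 BC1.
transitivity ((2 * B - C) / (B * (B - C))); first by field; rewrite BC0 B0.
apply/eqP; rewrite eqr_div ?mulf_neq0//; apply/eqP.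
transitivity (3 * (B * (B - C)) + 4 * (B * C) - (B ^+ 2 + C ^+ 2)); first by ring.
by rewrite BC; ring.
Qed.

(** For a collinear configuration the coordinate [a] vanishes.  Moving [a]
    across the line spreads the points and lowers the energy; moving it along the
    line raises the energy. *)
Let aligned_saddle Gamma zc I u (beta gamma : R) :
  Gamma != 0 -> 0 < I -> modulus u = 1 ->
  beta ^+ 2 + gamma ^+ 2 = 4 * I ->
  beta ^+ 4 + gamma ^+ 4 = 4 * (beta ^+ 2 * gamma ^+ 2) ->
  saddle_point Gamma zc I (quad zc (u * 0) (u * beta%:C) (u * gamma%:C)).
Proof.
move=> G0 I0 u1 sumI aligned.
have alignedB : (beta ^+ 2) ^+ 2 + (gamma ^+ 2) ^+ 2 = 4 * (beta ^+ 2 * gamma ^+ 2).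
  by rewrite -aligned; ring.
have alignedC : (gamma ^+ 2) ^+ 2 + (beta ^+ 2) ^+ 2 = 4 * (gamma ^+ 2 * beta ^+ 2).
  by rewrite addrC alignedB; ring.
have sumC : gamma ^+ 2 + beta ^+ 2 = 4 * I by rewrite addrC.
have gt0 (x y : R) : x ^+ 2 + y ^+ 2 = 4 * I ->
    (x ^+ 2) ^+ 2 + (y ^+ 2) ^+ 2 = 4 * (x ^+ 2 * y ^+ 2) -> 0 < x ^+ 2.
  move=> xyI xyg; rewrite lt_def sqr_ge0 andbT; apply/eqP => x0.
  have yI : y ^+ 2 = 4 * I by lra.
  move: xyg; rewrite x0 yI mul0r mulr0 expr0n/= add0r => /eqP.
  by rewrite expf_eq0 mulf_eq0 pnatr_eq0 (gt_eqF I0).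
have B0 : 0 < beta ^+ 2 by exact: gt0 sumI alignedB.
have C0 : 0 < gamma ^+ 2.
  exact: gt0 sumC alignedC.
have BC : beta ^+ 2 - gamma ^+ 2 != 0.
  apply/eqP => BC; have BC' : beta ^+ 2 = gamma ^+ 2 by lra.
  move: alignedB; rewrite BC' -expr2; have := exprn_gt0 2 C0; lra.
set X0 : R := - beta ^+ 2 * (beta ^+ 2 - gamma ^+ 2) * gamma ^+ 2.
have disc0 : disc3 0 beta%:C gamma%:C = X0%:C by rewrite /disc3 /X0; ring.
have X0_neq0 : X0 != 0.
  by rewrite mulf_neq0 ?(gt_eqF C0)// mulf_neq0// oppr_eq0 gt_eqF.
have modC (x : R) : modulus x%:C ^+ 2 = x ^+ 2 by rewrite modulusR real_normK ?num_real.
have zI : phase_space zc I (quad zc (u * 0) (u * beta%:C) (u * gamma%:C)).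
  apply/phase_space_quad; rewrite !sqr_modulus_unit// (modC 0) !modC expr0n add0r.
  by rewrite -modulus_eq0 disc3_unit// disc0 modulus_eq0 fmorph_eq0.
(* [K] is the norm of the coordinate vector; [a] is displaced by [K delta]. *)
pose K := 2 * Num.sqrt I.
have K2 : K ^+ 2 = beta ^+ 2 + gamma ^+ 2.
  by rewrite exprMn sqr_sqrtr ?ltW// sumI; ring.
have K_ge0 : 0 <= K by rewrite mulr_ge0 ?sqrtr_ge0.
have leK (x : R) : x ^+ 2 <= K ^+ 2 -> `|x| <= K.
  by move=> xK; rewrite -(@ler_pXn2r _ 2) ?nnegrE// real_normK ?num_real.
have betaK : `|beta| <= K by apply: leK; rewrite K2; lra.
have gammaK : `|gamma| <= K by apply: leK; rewrite K2; lra.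
have scale_near (x k delta : R) : `|x| <= K -> `|k - 1| <= delta ->
    modulus (u * (k * x)%:C - u * x%:C) <= K * delta.
  move=> xK kd; rewrite -mulrBr modulusM u1 mul1r -rmorphB modulusR.
  by rewrite -{2}[x]mul1r -mulrBl normrM mulrC ler_pM.
have scale_mod (x k : R) : modulus (u * (k * x)%:C) ^+ 2 = k ^+ 2 * x ^+ 2.
  by rewrite sqr_modulus_unit// modC exprMn.
split.
- apply: relative_equilibrium_critical => //.
  have [_ disc_u] := (phase_space_quad _ _ _ _ _).1 zI.
  apply/relative_equilibrium_quad => //; first by rewrite gt_eqF.
  have BCsum : beta ^+ 2 + gamma ^+ 2 != 0 by rewrite sumI mulf_neq0// gt_eqF.
  have real_triple (x y : R) : 0 < x ^+ 2 -> x ^+ 2 - y ^+ 2 != 0 ->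
      x ^+ 2 + y ^+ 2 = 4 * I ->
      (x ^+ 2) ^+ 2 + (y ^+ 2) ^+ 2 = 4 * (x ^+ 2 * y ^+ 2) ->
      triple_equation I x%:C y%:C 0.
    move=> x0 xy xyI xyg; rewrite /triple_equation conjc_real mulrC; congr (_ * _).
    rewrite expr0n/= subr0 -!rmorphXn -rmorphB -!fmorphV -rmorphD/=.
    by rewrite aligned_reciprocals ?xyI// gt_eqF// mulr_gt0.
  have swap (x y w : R[i]) : triple_equation I x y w -> triple_equation I x w y.
    by rewrite /triple_equation addrC.
  have neq (x y : R) : x ^+ 2 - y ^+ 2 != 0 -> x%:C ^+ 2 != y%:C ^+ 2 :> R[i].
    by rewrite subr_eq0 -!rmorphXn (inj_eq (@complexI R)).
  have CB : gamma ^+ 2 - beta ^+ 2 != 0 by rewrite -opprB oppr_eq0.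
  have nB : beta%:C ^+ 2 != 0 ^+ 2 :> R[i].
    by apply: (neq beta 0); rewrite expr0n subr0 gt_eqF.
  have nC : gamma%:C ^+ 2 != 0 ^+ 2 :> R[i].
    by apply: (neq gamma 0); rewrite expr0n subr0 gt_eqF.
  split.
  + by rewrite /triple_equation mulr0 mul0r rmorph0 mulr0.
  + apply: triple_equation_unit => //; first exact: neq.
    exact: real_triple.
  + apply: triple_equation_unit => //; first exact: neq.
    exact/swap/real_triple.
- apply: (@not_local_extremum _ _ _ _ _ _ _ true K) => // delta d0 d4.
  have [k2 k0 k1] := sqrt_one_sub d0 d4; set k := Num.sqrt _ in k2 k0 k1.
  exists (u * ((K * delta)%:C * 'i%C)), (u * (k * beta)%:C), (u * (k * gamma)%:C).
  have dabs : `|delta| = delta by rewrite gtr0_norm.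
  split.
  + rewrite mulr0 subr0 !modulusM u1 mul1r modulus_i mulr1 modulusR normrM dabs.
    by rewrite ger0_norm.
  + exact: scale_near.
  + exact: scale_near.
  + rewrite !scale_mod sqr_modulus_unit// modulusM modulus_i mulr1 modC exprMn K2 k2.
    by rewrite -sumI; ring.
  have ii := mulii R.
  rewrite !disc3_unit// disc0 (_ : disc3 _ _ _ =
    (X0 * ((1 - delta ^+ 2) * (1 + 4 * delta ^+ 2 + (delta ^+ 2) ^+ 2)))%:C); last first.
    rewrite /X0 -aligned_up// -k2 -K2 /disc3.
    by ring: ii.
  rewrite !modulusR [`|X0 * _|]normrM ltr_pMr ?normr_gt0//.
  have e0 : 0 < delta ^+ 2 by exact: exprn_gt0.
  have e1 : delta ^+ 2 <= 4^-1 * delta by rewrite expr2 ler_wpM2r// ltW.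
  set e := delta ^+ 2 in e0 e1 *.
  have ee : e ^+ 2 <= 16^-1 * e by rewrite expr2 ler_wpM2r ?(ltW e0)//; lra.
  have ee0 : 0 <= e ^+ 2 by exact: sqr_ge0.
  have eee : e ^+ 3 <= 16^-1 * e ^+ 2 by rewrite exprS ler_wpM2r//; lra.
  apply: (lt_le_trans _ (ler_norm _)); lra.
- apply: (@not_local_extremum _ _ _ _ _ _ _ false K) => // delta d0 d4.
  have [k2 k0 k1] := sqrt_one_sub d0 d4; set k := Num.sqrt _ in k2 k0 k1.
  exists (u * (K * delta)%:C), (u * (k * beta)%:C), (u * (k * gamma)%:C).
  have dabs : `|delta| = delta by rewrite gtr0_norm.
  split.
  + rewrite mulr0 subr0 !modulusM u1 mul1r modulusR normrM dabs.
    by rewrite ger0_norm.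
  + exact: scale_near.
  + exact: scale_near.
  + rewrite !scale_mod K2 k2.
    by rewrite -sumI; ring.
  rewrite !disc3_unit// disc0 (_ : disc3 _ _ _ =
    (X0 * ((1 - delta ^+ 2) * (1 - 8 * delta ^+ 2 + 13 * (delta ^+ 2) ^+ 2)))%:C);
    last first.
    by rewrite /X0 -aligned_down// -k2 -K2 /disc3; ring.
  have e0 : 0 < delta ^+ 2 by exact: exprn_gt0.
  have e1 : delta ^+ 2 <= 4^-1 * delta by rewrite expr2 ler_wpM2r// ltW.
  set e := delta ^+ 2 in e0 e1 *.
  have ee : e ^+ 2 <= 16^-1 * e by rewrite expr2 ler_wpM2r ?(ltW e0)//; lra.
  have ee0 : 0 <= e ^+ 2 by exact: sqr_ge0.
  have eee : e ^+ 3 <= 16^-1 * e ^+ 2 by rewrite exprS ler_wpM2r//; lra.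
  have f0 : 0 < (1 - e) * (1 - 8 * e + 13 * e ^+ 2).
    apply: mulr_gt0; first by lra.
    by lra.
  rewrite !modulusR [`|X0 * _|]normrM gtr_pMr ?normr_gt0// (gtr0_norm f0) mulr_gt0 ?normr_gt0//=.
  have := exprn_ge0 3 (ltW e0); lra.
Qed.

Lemma collinear_saddle_point Gamma zc I z : Gamma != 0 -> 0 < I ->
  congruent zc (collinear_shape I) z -> saddle_point Gamma zc I z.
Proof.
move=> G0 I0 /congruent_quad; have [-> -> -> ->] := collinear_shapeE I.
have [r1_gt0 r2_gt0] := sqr_collinear_radius R.
set s := Num.sqrt 6; set r1 := collinear_radius R true in r1_gt0 *.
set r2 := collinear_radius R false in r2_gt0 *; set q := Num.sqrt I.
have s6 : s ^+ 2 = 6 by rewrite sqr_sqrtr.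
have qI : q ^+ 2 = I by rewrite sqr_sqrtr// ltW.
move=> r1E r2E; case; first by ring.
move=> sigma [u [u1 zE]]; apply: (@saddle_point_perm _ _ _ _ _ sigma).
have := @aligned_saddle Gamma zc I u (2 * (r1 + r2) * q) (2 * (r1 - r2) * q)
  G0 I0 u1.
have -> : quad zc (u * 0) (u * (2 * (r1 + r2) * q)%:C) (u * (2 * (r1 - r2) * q)%:C)
    = z \o sigma by rewrite zE; congr quad; ring.
apply.
- transitivity (8 * (r1 ^+ 2 + r2 ^+ 2) * q ^+ 2); first by ring.
  by rewrite r1E r2E qI; field.
- apply/eqP; rewrite -subr_eq0; apply/eqP.
  transitivity ((64 * (r1 ^+ 2 + r2 ^+ 2) ^+ 2 - 96 * (r1 ^+ 2 - r2 ^+ 2) ^+ 2)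
    * q ^+ 4); first by ring.
  rewrite r1E r2E; transitivity ((16 - 96 * s ^+ 2 / 36) * q ^+ 4); first by field.
  by rewrite s6; field.
Qed.

Let zeta : R[i] := cube_root R.

Let zeta3 : zeta ^+ 3 = 1.
Proof.
have := cube_rootE R; rewrite -/zeta => z.
have : (zeta - 1) * (zeta ^+ 2 + zeta + 1) = 0 by rewrite z mulr0.
by move=> h; apply/eqP; rewrite -subr_eq0; apply/eqP; rewrite -h; ring.
Qed.

Let zeta2 : zeta ^+ 2 = - zeta - 1.
Proof.
by apply/eqP; rewrite -subr_eq0; apply/eqP; rewrite -(cube_rootE R) -/zeta; ring.
Qed.

Let modulus_zeta : modulus zeta = 1.
Proof. exact: modulus_cexpi. Qed.

Let conj_zeta : zeta^* = zeta ^+ 2.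
Proof.
have z0 : zeta != 0 by rewrite -modulus_eq0 modulus_zeta oner_eq0.
apply: (mulfI z0); rewrite -exprS zeta3.
by have := sqr_modulus zeta; rewrite modulus_zeta expr1n.
Qed.

(** The law of cosines at an angle of 120 degrees. *)
Let sqr_modulus_weights (P Q : R) :
  modulus (P%:C - Q%:C * zeta ^+ 2) ^+ 2 = P ^+ 2 + P * Q + Q ^+ 2.
Proof.
have cE : (P%:C - Q%:C * zeta ^+ 2)^* = P%:C - Q%:C * zeta.
  transitivity ((P%:C)^* - (Q%:C * zeta ^+ 2)^*); first exact: rmorphB.
  rewrite conjc_real conjc_scale; congr (_ - _ * _).
  transitivity ((zeta^*) ^+ 2); first exact: rmorphXn.
  by rewrite conj_zeta; transitivity (zeta * zeta ^+ 3);
    [ring | rewrite zeta3 mulr1].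
apply: complexI; rewrite sqr_modulus cE.
transitivity (P%:C ^+ 2 - (zeta ^+ 2 + zeta) * (P%:C * Q%:C)
  + zeta ^+ 3 * Q%:C ^+ 2); first by ring.
by rewrite zeta3 zeta2; ring.
Qed.

Let disc3_weights (x y w : R) :
  modulus (disc3 x%:C (y%:C * zeta) (w%:C * zeta ^+ 2)) ^+ 2 =
  ((x ^+ 2) ^+ 2 + x ^+ 2 * y ^+ 2 + (y ^+ 2) ^+ 2)
  * ((y ^+ 2) ^+ 2 + y ^+ 2 * w ^+ 2 + (w ^+ 2) ^+ 2)
  * ((w ^+ 2) ^+ 2 + w ^+ 2 * x ^+ 2 + (x ^+ 2) ^+ 2).
Proof.
have -> : disc3 x%:C (y%:C * zeta) (w%:C * zeta ^+ 2)
    = ((x ^+ 2)%:C - (y ^+ 2)%:C * zeta ^+ 2)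
    * (zeta ^+ 2 * ((y ^+ 2)%:C - (w ^+ 2)%:C * zeta ^+ 2))
    * (zeta * ((w ^+ 2)%:C - (x ^+ 2)%:C * zeta ^+ 2)).
  have -> : zeta * ((w ^+ 2)%:C - (x ^+ 2)%:C * zeta ^+ 2)
      = zeta * (w ^+ 2)%:C * zeta ^+ 3 - (x ^+ 2)%:C.
    transitivity (zeta * (w ^+ 2)%:C - (x ^+ 2)%:C * zeta ^+ 3); first by ring.
    by rewrite zeta3 !mulr1.
  by rewrite /disc3; ring.
by rewrite !modulusM modulus_zeta !mul1r !exprMn !sqr_modulus_weights.
Qed.

(** Changing the moduli of [A], [B], [C] from [p^2] to [p^2 (1 + delta)],
    [p^2 (1 - delta)], [p^2] changes [|disc3|^2] from [27 p^12] to
    [(27 + delta^6) p^12]: the energy decreases, though only to sixth order.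
    Turning [A] alone away from the equilateral position multiplies [|disc3|] by
    [(3 - 4 delta^2) / 3]. *)
Let equilateral_saddle Gamma zc I u (p : R) :
  Gamma != 0 -> 0 < I -> modulus u = 1 -> 0 < p -> 3 * p ^+ 2 = 4 * I ->
  saddle_point Gamma zc I
    (quad zc (u * p%:C) (u * (p%:C * zeta)) (u * (p%:C * zeta ^+ 2))).
Proof.
move=> G0 I0 u1 p0 pI.
have p6 : 0 < p ^+ 6 by exact: exprn_gt0.
have pC : p%:C != 0 :> R[i] by rewrite fmorph_eq0 gt_eqF.
have z0 : zeta != 0 by rewrite -modulus_eq0 modulus_zeta oner_eq0.
have modp : modulus p%:C = p by rewrite modulus_real ?ltW.
have zz : modulus (zeta ^+ 2) = 1 by rewrite modulusX modulus_zeta expr1n.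
have sqr_disc : modulus (disc3 p%:C (p%:C * zeta) (p%:C * zeta ^+ 2)) ^+ 2
    = 27 * (p ^+ 6) ^+ 2 by rewrite disc3_weights; ring.
have disc_gt0 : 0 < modulus (disc3 p%:C (p%:C * zeta) (p%:C * zeta ^+ 2)).
  by rewrite lt_def modulus_ge0 andbT -sqrf_eq0 sqr_disc mulf_neq0// expf_neq0// gt_eqF.
have disc_neq0 : disc3 p%:C (p%:C * zeta) (p%:C * zeta ^+ 2) != 0.
  by rewrite -modulus_gt0.
have [n1 n2 n3] := disc3_distinct disc_neq0.
have disc_u : disc3 (u * p%:C) (u * (p%:C * zeta)) (u * (p%:C * zeta ^+ 2)) != 0.
  by rewrite -modulus_gt0 disc3_unit.
have zI : phase_space zc I
    (quad zc (u * p%:C) (u * (p%:C * zeta)) (u * (p%:C * zeta ^+ 2))).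
  apply/phase_space_quad; split=> //.
  rewrite !(sqr_modulus_unit _ u1) !modulusM modulus_zeta !mulr1 modp -pI; ring.
split.
- apply: relative_equilibrium_critical => //.
  apply/relative_equilibrium_quad => //; first by rewrite gt_eqF.
  have base : triple_equation I p%:C (p%:C * zeta) (p%:C * zeta ^+ 2).
    rewrite /triple_equation conjc_real -pI mulrC; congr (_ * _).
    have w2 : 2 + zeta != 0.
      apply/eqP => w2; case/eqP: n1; rewrite exprMn zeta2.
      have -> : - zeta - 1 = 1 - (2 + zeta) by ring.
      by rewrite w2 subr0 mulr1.
    have w1 : 1 - zeta != 0.
      apply/eqP => w1; case/eqP: n1; rewrite exprMn.
      have -> : zeta = 1 - (1 - zeta) by ring.
      by rewrite w1 subr0 expr1n mulr1.
    have -> : (p%:C * zeta) ^+ 2 = p%:C ^+ 2 * (- zeta - 1).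
      by rewrite exprMn zeta2.
    have -> : (p%:C * zeta ^+ 2) ^+ 2 = p%:C ^+ 2 * zeta.
      transitivity (p%:C ^+ 2 * (zeta * zeta ^+ 3)); first by ring.
      by rewrite zeta3 mulr1.
    have -> : (3 / (3 * p ^+ 2))%:C = (p%:C ^+ 2)^-1 :> R[i].
      rewrite -rmorphXn -fmorphV/=; congr (_%:C); field.
      by rewrite gt_eqF.
    transitivity ((p%:C ^+ 2)^-1 * ((2 + zeta)^-1 + (1 - zeta)^-1)).
      have d1 : p%:C ^+ 2 - p%:C ^+ 2 * (- zeta - 1) != 0.
        rewrite (_ : _ - _ = p%:C ^+ 2 * (2 + zeta)); last by ring.
        by rewrite mulf_neq0 ?expf_neq0.
      have d2 : p%:C ^+ 2 - p%:C ^+ 2 * zeta != 0.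
        rewrite (_ : _ - _ = p%:C ^+ 2 * (1 - zeta)); last by ring.
        by rewrite mulf_neq0 ?expf_neq0.
      by field; rewrite w1 w2 pC d1 d2.
    rewrite -[RHS]mulr1; congr (_ * _).
    transitivity (3 / (2 - zeta - zeta ^+ 2)).
      have -> : 2 - zeta - zeta ^+ 2 = (2 + zeta) * (1 - zeta) by ring.
      by field; rewrite w1 w2.
    by rewrite zeta2 (_ : _ - _ = 3) ?divff//; ring.
  have turn a b c : a ^+ 2 != b ^+ 2 -> a ^+ 2 != c ^+ 2 ->
      triple_equation I a b c ->
      triple_equation I (zeta * a) (zeta * b) (zeta * c).
    exact: triple_equation_unit modulus_zeta.
  have t1 : zeta * p%:C = p%:C * zeta by rewrite mulrC.
  have t2 : zeta * (p%:C * zeta) = p%:C * zeta ^+ 2 by ring.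
  have t3 : zeta * (p%:C * zeta ^+ 2) = p%:C.
    by transitivity (p%:C * zeta ^+ 3); [ring | rewrite zeta3 mulr1].
  have n1' : (p%:C * zeta) ^+ 2 != p%:C ^+ 2 by rewrite eq_sym.
  have n2' : (p%:C * zeta ^+ 2) ^+ 2 != (p%:C * zeta) ^+ 2 by rewrite eq_sym.
  have n3' : p%:C ^+ 2 != (p%:C * zeta ^+ 2) ^+ 2 by rewrite eq_sym.
  have base2 := turn _ _ _ n1 n3' base; rewrite t1 t2 t3 in base2.
  have base3 := turn _ _ _ n2 n1' base2; rewrite t1 t2 t3 in base3.
  by split; apply: triple_equation_unit.
- apply: (@not_local_extremum _ _ _ _ _ _ _ true p) => // delta d0 d4.
  have sqrt_near (x : R) : 0 <= 1 + x -> `|x| <= delta ->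
      `|Num.sqrt (1 + x) - 1| <= delta.
    move=> x1 xd; apply: le_trans xd.
    have s0 : 0 <= Num.sqrt (1 + x) by exact: sqrtr_ge0.
    have := sqr_sqrtr x1; move: (Num.sqrt (1 + x)) s0 => s s0 s2.
    have -> : x = (s - 1) * (s + 1) by rewrite -subr_sqr_1 s2; ring.
    by rewrite normrM ler_peMr// ger0_norm; lra.
  have x1 : 0 <= 1 + delta by lra.
  have y1 : 0 <= 1 + (- delta) by lra.
  have sx := sqrt_near _ x1; have sy := sqrt_near _ y1.
  set x := Num.sqrt (1 + delta) in sx; set y := Num.sqrt (1 + - delta) in sy.
  have x2 : x ^+ 2 = 1 + delta by rewrite sqr_sqrtr.
  have y2 : y ^+ 2 = 1 - delta by rewrite sqr_sqrtr.
  exists (u * (x * p)%:C), (u * ((y * p)%:C * zeta)), (u * (p%:C * zeta ^+ 2)).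
  split.
  + rewrite -mulrBr modulusM u1 mul1r -rmorphB modulusR -{2}[p]mul1r -mulrBl.
    by rewrite normrM mulrC (gtr0_norm p0) ler_wpM2l ?(ltW p0)// sx// gtr0_norm.
  + rewrite -mulrBr modulusM u1 mul1r -mulrBl modulusM modulus_zeta mulr1.
    rewrite -rmorphB modulusR -{2}[p]mul1r -mulrBl normrM mulrC (gtr0_norm p0).
    by rewrite ler_wpM2l ?(ltW p0)// sy// normrN gtr0_norm.
  + by rewrite subrr (modulus_real (lexx 0)) mulr_ge0 ?ltW.
  + rewrite !(sqr_modulus_unit _ u1) !modulusM modulus_zeta !mulr1 !modulusR.
    rewrite !real_normK ?num_real// !exprMn x2 y2 -pI; ring.
  rewrite !disc3_unit// -(@ltr_pXn2r _ 2) ?nnegrE ?modulus_ge0// sqr_disc.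
  rewrite disc3_weights [(x * p) ^+ 2]exprMn [(y * p) ^+ 2]exprMn x2 y2.
  rewrite [ltRHS](_ : _ = (27 + delta ^+ 6) * (p ^+ 6) ^+ 2); last by ring.
  by rewrite ltr_pM2r ?exprn_gt0// ltrDl exprn_gt0.
- apply: (@not_local_extremum _ _ _ _ _ _ _ false (2 * p)) => // delta d0 d4.
  have [k2 k0 k1] := sqrt_one_sub d0 d4; set k := Num.sqrt _ in k2 k0 k1.
  (* a unit number close to [1]; its square has real part [1 - 2 delta^2] *)
  pose v : R[i] := k +i* delta.
  have vE : v = k%:C + delta%:C * 'i%C by rewrite /v; simpc.
  have v1 : modulus v = 1.
    by rewrite /v /modulus/= k2 subrK sqrtr1.
  have vk : v ^+ 2 + 1 = 2 * k%:C * v.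
    have ii := mulii R; have kC : k%:C ^+ 2 = 1 - delta%:C ^+ 2 :> R[i].
      by rewrite -!rmorphXn/= k2 rmorphB/= rmorph1.
    by rewrite vE; ring: ii kC.
  have v4 : v ^+ 4 + v ^+ 2 + 1 = (3 - 4 * delta ^+ 2)%:C * v ^+ 2.
    transitivity ((v ^+ 2 + 1) ^+ 2 - v ^+ 2); first by ring.
    rewrite vk; transitivity ((4 * k ^+ 2 - 1)%:C * v ^+ 2); first by ring.
    by rewrite k2; congr (_%:C * _); ring.
  have discv (w : R[i]) : disc3 (p%:C * w) (p%:C * zeta) (p%:C * zeta ^+ 2)
      = p%:C ^+ 6 * (zeta - zeta ^+ 2) * (w ^+ 4 + w ^+ 2 + 1).
    transitivity (p%:C ^+ 6 * (zeta * zeta ^+ 3 - zeta ^+ 2)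
      * (w ^+ 4 - (zeta * zeta ^+ 3 + zeta ^+ 2) * w ^+ 2 + (zeta ^+ 3) ^+ 2)).
      by rewrite /disc3; ring.
    by rewrite zeta3 zeta2; ring.
  have disc1 := discv 1; rewrite mulr1 !expr1n in disc1.
  exists (u * (p%:C * v)), (u * (p%:C * zeta)), (u * (p%:C * zeta ^+ 2)).
  have K0 : 0 <= 2 * p * delta by rewrite !mulr_ge0 ?ltW.
  split.
  + rewrite -mulrBr modulusM u1 mul1r -[X in _ - X]mulr1 -mulrBr modulusM modp.
    rewrite [2 * p]mulrC -mulrA ler_wpM2l ?(ltW p0)//.
    have -> : v - 1 = (k - 1)%:C + delta%:C * 'i%C by rewrite vE; ring.
    rewrite (le_trans (ler_modulusD _ _))// modulusM modulus_i mulr1 !modulusR.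
    by rewrite (gtr0_norm d0); lra.
  + by rewrite subrr (modulus_real (lexx 0)).
  + by rewrite subrr (modulus_real (lexx 0)).
  + rewrite !(sqr_modulus_unit _ u1) !modulusM modulus_zeta v1 !mulr1 modp -pI; ring.
  have f0 : 0 < (3 - 4 * delta ^+ 2) / 3 by rewrite divr_gt0//; nra.
  rewrite !(disc3_unit _ _ _ u1) (_ : disc3 (p%:C * v) _ _ =
    disc3 p%:C (p%:C * zeta) (p%:C * zeta ^+ 2)
      * (((3 - 4 * delta ^+ 2) / 3)%:C * v ^+ 2)); last first.
    by rewrite discv disc1 v4 [in RHS]rmorphM fmorphV/= rmorph_nat; field.
  rewrite modulusM [modulus (_%:C * _)]modulusM modulusX v1 expr1n mulr1.
  rewrite modulusR (gtr0_norm f0) mulr_gt0//= gtr_pMr//.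
  have := exprn_gt0 2 d0; lra.
Qed.

Lemma triangle_saddle_point Gamma zc I z : Gamma != 0 -> 0 < I ->
  congruent zc (triangle_shape I) z -> saddle_point Gamma zc I z.
Proof.
move=> G0 I0 /congruent_quad; have [-> -> -> ->] := triangle_shapeE I.
rewrite -/zeta; set r := _ * Num.sqrt I.
have r0 : 0 < r by rewrite mulr_gt0 ?invr_gt0 ?sqrtr_gt0.
case; first by rewrite zeta2; ring.
move=> sigma [u [u1 zE]]; apply: (@saddle_point_perm _ _ _ _ _ sigma).
have := @equilateral_saddle Gamma zc I u (2 * r) G0 I0 u1.
have -> : quad zc (u * (2 * r)%:C) (u * ((2 * r)%:C * zeta))
    (u * ((2 * r)%:C * zeta ^+ 2)) = z \o sigma.
  rewrite zE; congr quad; congr (u * _).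
  - by rewrite zeta2; ring.
  - by rewrite zeta2; ring.
  - by rewrite zeta2; ring.
apply; first by rewrite mulr_gt0.
by rewrite !exprMn exprVn !sqr_sqrtr ?ltW//; field.
Qed.

End SaddleConfigurations.

(** * Stationary motions *)
Section Motions.
Variable R : realType.
Implicit Types (Gamma I t theta : R) (zc u : R[i]) (s : quadruple R).

Lemma is_cderive_unique (w : R -> R[i]) t dw dw' :
  is_cderive w t dw -> is_cderive w t dw' -> dw = dw'.
Proof.
move=> [dr di] [dr' di'].
have := @derive_val _ _ _ _ _ _ _ dr; rewrite (@derive_val _ _ _ _ _ _ _ dr').
have := @derive_val _ _ _ _ _ _ _ di; rewrite (@derive_val _ _ _ _ _ _ _ di').
by case: dw {dr di} => a b; case: dw' {dr' di'} => c d /= -> ->.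
Qed.

(** The rigid rotation of the initial configuration solves the equations of
    motion, so uniqueness identifies it with the given solution. *)
Lemma stationary_motion Gamma zc I (z : R -> quadruple R) :
  Gamma != 0 -> I != 0 -> kirchhoff_solution Gamma z ->
  (forall t, configuration (z t)) -> phase_space zc I (z 0) ->
  stationary Gamma (z 0) ->
  z = rigid_motion Gamma I zc (fun j => z 0 j - zc).
Proof.
move=> G0 I0 zE zconf zI zstat.
have RE := stationary_relative_equilibrium G0 I0 zI zstat.
set y := rigid_motion _ _ _ _.
have yconf t : configuration (y t).
  move=> i j ij; rewrite /y /rigid_motion (inj_eq (addrI _)).
  have e0 : cexpi (omega Gamma I * t) != 0 :> R[i].
    by rewrite -modulus_eq0 modulus_cexpi oner_eq0.
  by rewrite (inj_eq (mulfI e0)) (inj_eq (addIr _)) zconf.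
have fieldE (x : quadruple R) j : configuration x ->
    vortex_field Gamma x j = velocity Gamma x j.
  by move=> xconf; rewrite velocityE.
apply: (@follows_field_unique _ Gamma) => //.
- by move=> t j; rewrite fieldE//; exact: kirchhoff_is_cderive.
- move=> t j; rewrite fieldE// (relative_equilibrium_velocity (zc := zc) _ G0 I0) //; last first.
    exact: relative_equilibrium_rigid (modulus_cexpi _) RE.
  rewrite [X in _ * X](_ : _ = cexpi (omega Gamma I * t) * (z 0 j - zc)).
    exact: is_cderive_rigid.
  by rewrite /y /rigid_motion addrC addKr.
- apply/funext => j; rewrite /y /rigid_motion mulr0 cexpi0 mul1r addrC subrK//.
Qed.

Lemma transformed_rigid Gamma I zc s (sigma : 'S_4) theta (z : quadruple R) t :
  transformed zc sigma theta z =1 rigid_motion Gamma I zc s t <->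
  forall j, z (sigma j) = zc + cexpi (- theta) * (cexpi (omega Gamma I * t) * s j).
Proof.
split=> E j; last first.
  rewrite /transformed /rotation E [zc + _ - _]addrC addKr mulrA -cexpiD subrr.
  by rewrite cexpi0 mul1r.
have := E j; rewrite /transformed /rotation /rigid_motion => /addrI <-.
by rewrite mulrA -cexpiD addNr cexpi0 mul1r addrC subrK.
Qed.

Lemma congruent_rigid_motion Gamma I zc s (z : R -> quadruple R) :
  z = rigid_motion Gamma I zc (fun j => z 0 j - zc) -> congruent zc s (z 0) ->
  exists (sigma : 'S_4) theta,
    forall t, transformed zc sigma theta (z t) =1 rigid_motion Gamma I zc s t.
Proof.
move=> zE [sigma [u [u1 z0E]]]; have [theta thetaE] := cexpi_surj u1.
exists sigma, (- theta) => t; apply/transformed_rigid => j.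
rewrite zE /rigid_motion z0E opprK thetaE [zc + _ - _]addrC addKr.
by rewrite mulrCA.
Qed.

(** The velocity field at time [0] is read off from the explicit motion. *)
Lemma rigid_motion_stationary Gamma I zc s (z : R -> quadruple R)
    (sigma : 'S_4) theta : Gamma != 0 ->
  kirchhoff_solution Gamma z -> configuration (z 0) ->
  (forall t, transformed zc sigma theta (z t) =1 rigid_motion Gamma I zc s t) ->
  stationary Gamma (z 0).
Proof.
move=> G0 zE zconf zM; split=> //.
pose w k := cexpi (- theta) * s ((sigma^-1)%g k).
have zw t k : z t k = zc + cexpi (omega Gamma I * t) * w k.
  have /transformed_rigid/(_ ((sigma^-1)%g k)) := zM t.
  by rewrite permKV => ->; rewrite mulrCA.
exists ('i%C * (omega Gamma I)%:C) => i j _.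
have vE k : velocity Gamma (z 0) k = 'i%C * (omega Gamma I)%:C * (z 0 k - zc).
  have d1 := kirchhoff_is_cderive 0 k G0 zE.
  have d2 := is_cderive_rigid zc (omega Gamma I) (w k) 0.
  have zkE : (fun t => z t k) = fun t => zc + cexpi (omega Gamma I * t) * w k.
    by apply/funext => t; exact: zw.
  rewrite -zkE in d2; rewrite (is_cderive_unique d1 d2) zw.
  by rewrite [zc + _ - _]addrC addKr.
by rewrite !vE; ring.
Qed.

End Motions.

Theorem theorem1p4 (R : realType) (Gamma : R) (zc : R[i]) (I : R)
    (hGamma : Gamma != 0) (hI : 0 < I) :
  (forall z : R -> quadruple R,
     kirchhoff_solution Gamma z ->
     (forall t : R, configuration (z t)) ->
     vortex_center (z 0) = zc ->
     vortex_impulse (z 0) = I ->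
     (stationary Gamma (z 0) <->
      exists (sigma : 'S_4) (theta : R),
        [\/ forall t : R, transformed zc sigma theta (z t)
                            =1 square_motion Gamma zc I t,
            forall t : R, transformed zc sigma theta (z t)
                            =1 collinear_motion Gamma zc I t
          | forall t : R, transformed zc sigma theta (z t)
                            =1 triangle_motion Gamma zc I t]))
  /\ (forall z : quadruple R,
        global_minimizer Gamma zc I z <->
        position_of zc (square_motion Gamma zc I) z)
  /\ (forall z : quadruple R,
        position_of zc (collinear_motion Gamma zc I) z ->
        saddle_point Gamma zc I z)
  /\ (forall z : quadruple R,
        position_of zc (triangle_motion Gamma zc I) z ->
        saddle_point Gamma zc I z).
Proof.
rewrite square_motionE collinear_motionE triangle_motionE.
split; last split; last split.
- move=> z zE zconf zc0 zI0.
  have zI : phase_space zc I (z 0) by exact: phase_space_of_conserved.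
  have I0 : I != 0 by rewrite gt_eqF.
  split=> [zstat|[sigma [theta]]].
    have RE := stationary_relative_equilibrium hGamma I0 zI zstat.
    have zM := stationary_motion hGamma I0 zE zconf zI zstat.
    have [] := relative_equilibrium_congruent hI zI RE;
      move=> /(congruent_rigid_motion zM)[sigma [theta h]]; exists sigma, theta.
    + by constructor 1.
    + by constructor 2.
    + by constructor 3.
  by case=> h; exact: rigid_motion_stationary h.
- by move=> z; rewrite position_ofP; exact: global_minimizerP.
- by move=> z /position_ofP; exact: collinear_saddle_point.
- by move=> z /position_ofP; exact: triangle_saddle_point.
Qed.
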